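(* Let $(\nabla,h)$ be a rank $k$ uniformly hyperbolic bundle. Then its limit map $\xi:\partial_\infty\mathbb H^2\to\mathrm{Gr}_k(V)$ and its dual limit map $\xi^*:\partial_\infty\mathbb H^2\to\mathrm{Gr}_k(V^* )$ are H\''older.
   Context: $\mathsf U\mathbb H^2$ is the unit tangent bundle of the hyperbolic plane, $(\phi_t)$ its geodesic flow; $\varpi^+,\varpi^-:\mathsf U\mathbb H^2\to\partial_\infty\mathbb H^2$ are the projections whose fibres are the central stable, respectively central unstable, leaves (forward and backward endpoints). $V$ is a finite-dimensional vector space and $E=V\times\mathsf U\mathbb H^2$. A frame $h$ on $E$ defines the metric for which it is orthonormal, with norms $\|\cdot\|_x$ on $E_x$. $\angle_x(F,G)=\inf\{\angle_x(u,v)\mid u\in F,v\in G\text{ non zero}\}$ for subspaces of $E_x$; $d_x$ is the associated distance of diameter $1$ on Grassmannians of $E_x$. $\mathrm{Gr}_k(E^* )$ is identified with $\mathrm{Gr}_{\dim V-k}(E)$. For a flat connection $\nabla$, $\Phi^\nabla_t$ is the lift of $\phi_t$ to $E$ by parallel transport along flow lines. A rank $k$ uniformly hyperbolic bundle is a pair $(\nabla,h)$, with $h$ a frame on $E$ and $\nabla$ a trivializable connection on $E$, such that $\|\Phi^\nabla_{1}\|$, $\|\Phi^\nabla_{-1}\|$ are uniformly bounded and there is a $\Phi^\nabla_t$-invariant decomposition $E_x=L_x\oplus P_x$ (not a priori continuous in $x$), $\dim L_x=k$, such that (1) there is a volume form on $E$ bounded with respect to $h$ and $\nabla$-parallel along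 flow orbits; (2) there are $B,b>0$ with $\frac{\|\Phi^\nabla_s(u)\|_{\phi_s(x)}}{\|u\|_x}\le Be^{-bs}\frac{\|\Phi^\nabla_s(v)\|_{\phi_s(x)}}{\|v\|_x}$ for all $s>0$, all $x$ and all nonzero $u\in L_x$, $v\in P_x$; (3) if $\mathcal L$, $\mathcal P$ are the closures of the images of $L$ and $P$ in the Grassmann bundles, there is $\epsilon_0>0$ with $\angle_x(\mathbf u,\mathbf v)>2\epsilon_0$ for all $x$, $\mathbf u\in\mathcal L_x$, $\mathbf v\in\mathcal P_x$; (4) in a trivialization where $\nabla$ is trivial there is a continuous decomposition $E=L^\infty\oplus P^\infty$ (viewed as maps to $\mathrm{Gr}_k(V)\times\mathrm{Gr}_k(V^* )$) and constants $\epsilon_1>0$, $H,\alpha>0$ with $\angle_x(L^\infty_x,P^\infty_x)>\epsilon_1$, $d_x(L^\infty_x,L^\infty_y)\le H\,d(x,y)^\alpha$ for all $x,y$, and the same for $P^\infty$. (The paper chooses $\epsilon_0=\epsilon_1$.) Limit maps: choose a trivialization $E=V\times\mathsf U\mathbb H^2$ in which $\nabla$ is trivial. Then $L$ is constant along central stable leaves and $P$ along central unstable leaves; $\xi$ and $\xi^*$ are the maps defined by $\xi(\varpi^+(y))=L_y$ and $\xi^*(\varpi^-(y))=P_y$ for $y\in\mathsf U\mathbb H^2$. H\''older is with respect to the standard smooth structures on the circle $\partial_\infty\mathbb H^2$ and on Grassmannians.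
   Formalization: Condition (4) as written does not relate L^∞, P^∞ to L, P, and the claim is then false (dim V = 3, k = 1, constant L^∞ inside P); it is strengthened by requiring the angles between L^∞ and P and between L and P^∞ to exceed ε_1 at every point. *)

(* Defs.v *)
(* MathComp / MathComp-Analysis *)
From HB Require Import structures.
From mathcomp Require Import all_boot all_order all_algebra.
From mathcomp Require Import all_classical all_reals all_analysis.

Set Implicit Arguments.
Unset Strict Implicit.
Unset Printing Implicit Defensive.

Import Order.TTheory GRing.Theory Num.Theory numFieldNormedType.Exports.

Local Open Scope classical_set_scope.
Local Open Scope ring_scope.

(* The hyperboloid model: H^2 is the sheet <p,p> = -1, p_0 > 0 of R^{2,1}, and
   a unit tangent vector is a pair (p, v) with <p,v> = 0 and <v,v> = 1. *)
Notation pt R := ('rV[R]_3 * 'rV[R]_3)%type.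

Section Hyperbolic.
Variable R : realType.
Local Notation pt := (pt R).

Definition lor (p q : 'rV[R]_3) : R :=
  p 0 1 * q 0 1 + p 0 2%:R * q 0 2%:R - p 0 0 * q 0 0.

Definition UH : set pt :=
  [set x | [/\ lor x.1 x.1 = -1, 0 < x.1 0 0, lor x.1 x.2 = 0
             & lor x.2 x.2 = 1]].

Definition ch (t : R) : R := (expR t + expR (- t)) / 2.
Definition sh (t : R) : R := (expR t - expR (- t)) / 2.

Definition flow (t : R) (x : pt) : pt :=
  (ch t *: x.1 + sh t *: x.2, sh t *: x.1 + ch t *: x.2).

(* The boundary at infinity is the projectivised light cone; the ray through
   the light-like vector q is encoded by (q_1 / q_0, q_2 / q_0). *)
Definition circle : set (R * R) := [set s | s.1 ^+ 2 + s.2 ^+ 2 = 1].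

Definition ray (q : 'rV[R]_3) : R * R := (q 0 1 / q 0 0, q 0 2%:R / q 0 0).

Definition fwd (x : pt) : R * R := ray (x.1 + x.2).
Definition bwd (x : pt) : R * R := ray (x.1 - x.2).

Definition C1_curve (c : R -> pt) : Prop :=
  [/\ forall t, UH (c t), forall t, derivable c t 1 & continuous (derive1 c)].

(* The Sasaki norm of the tangent vector w at x: the second term is the norm of
   the covariant derivative, i.e. of the projection of w.2 to x.1^\perp. *)
Definition sasaki_norm (x w : pt) : R :=
  let Dv := w.2 + lor w.2 x.1 *: x.1 in
  Num.sqrt (lor w.1 w.1 + lor Dv Dv).

Definition curve_length (c : R -> pt) : R :=
  \int[@lebesgue_measure R]_(t in `[0, 1]) sasaki_norm (c t) (derive1 c t).

Definition distUH (x y : pt) : R :=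
  inf [set l | exists c, [/\ C1_curve c, c 0 = x, c 1 = y
                           & l = curve_length c]].

End Hyperbolic.

Section Metric.
Variables (R : realType) (V : vectType R).

Definition frame : Type := (\dim {: V}).-tuple V.

Definition dotf (X : frame) (u v : V) : R :=
  \sum_i coord X i u * coord X i v.

Definition normf (X : frame) (u : V) : R := Num.sqrt (dotf X u u).

Definition vangle (X : frame) (u v : V) : R :=
  acos (dotf X u v / (normf X u * normf X v)).

(* In \bar R, so that the infimum is +oo when F or G is zero. *)
Definition angle (X : frame) (F G : {vspace V}) : \bar R :=
  ereal_inf [set a | exists u v, [/\ u \in F, v \in G, u != 0, v != 0
                                   & a = (vangle X u v)%:E]].

(* The distance on Grassmannians is the gap (operator norm of the difference of
   the orthogonal projectors), of diameter 1. *)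
Definition half_gap (X : frame) (F G : {vspace V}) : R :=
  sup [set a | exists u, [/\ u \in F, normf X u = 1
    & a = inf [set b | exists v, v \in G /\ b = normf X (u - v)]]].

Definition gap (X : frame) (F G : {vspace V}) : R :=
  Num.max (half_gap X F G) (half_gap X G F).

End Metric.

Section Bundle.
Variables (R : realType) (V : vectType R).
Local Notation pt := (pt R).
Local Notation UH := (@UH R).
Local Notation frame := (frame V).

(* A frame on V x UH^2. Continuity and differentiability of maps into V and
   End(V) are tested on linear forms. *)
Definition frame_field (h : pt -> frame) : Prop :=
  (forall x, UH x -> basis_of fullv (h x)) /\
  (forall i (l : 'Hom(V, R^o)),
     {within UH, continuous (fun x => l (tnth (h x) i) : R)}).

(* The connection D + A, D being the trivial connection on V x UH^2; only the
   values of A x on vectors tangent to UH^2 at x are ever used. *)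
Definition connection_form (A : pt -> {linear pt -> 'End(V)}) : Prop :=
  forall w u (l : 'Hom(V, R^o)),
    {within UH, continuous (fun x => l (A x w u) : R)}.

(* g carries D + A to D: d(g u) = g (du + A u), that is, dg = g A. *)
Definition trivialization (A : pt -> {linear pt -> 'End(V)})
    (g : pt -> 'End(V)) : Prop :=
  [/\ forall x, UH x -> lker (g x) = 0%VS,
      forall u (l : 'Hom(V, R^o)),
        {within UH, continuous (fun x => l (g x u) : R)}
    & forall c, C1_curve c -> forall t u (l : 'Hom(V, R^o)),
        is_derive t (1 : R) (fun s => l (g (c s) u) : R)
          (l (g (c t) (A (c t) (derive1 c t) u)))].

Definition trivializable (A : pt -> {linear pt -> 'End(V)}) : Prop :=
  connection_form A /\ exists g, trivialization A g.

Definition parallel (A : pt -> {linear pt -> 'End(V)})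
    (c : R -> pt) (s : R -> V) : Prop :=
  forall t (l : 'Hom(V, R^o)),
    is_derive t (1 : R) (fun r => l (s r) : R)
      (- l (A (c t) (derive1 c t) (s t))).

(* Phi t x : E_x -> E_(flow t x) is parallel transport along the flow line. *)
Definition flow_lift (A : pt -> {linear pt -> 'End(V)})
    (Phi : R -> pt -> 'End(V)) : Prop :=
  forall x, UH x -> forall u,
    Phi 0 x u = u /\ parallel A (fun t => flow t x) (fun t => Phi t x u).

Definition volume_form (w : ('I_(\dim {: V}) -> V) -> R) : Prop :=
  [/\ forall u i a v v',
        w (fun j => if j == i then a *: v + v' else u j) =
        a * w (fun j => if j == i then v else u j) +
        w (fun j => if j == i then v' else u j),
      forall u i j, i != j -> u i = u j -> w u = 0
    & exists u, w u != 0].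

(* The fibre over x of the closure of the image of L in the bundle of
   Grassmannians of k-planes of V x UH^2. *)
Definition closure_fibre (h : pt -> frame) (k : nat)
    (L : pt -> {vspace V}) (x : pt) : set {vspace V} :=
  [set W | \dim W = k /\
    forall (U : set pt) (e : R), nbhs x U -> 0 < e ->
      exists y, [/\ UH y, U y & gap (h x) (L y) W < e]].

Definition gr_continuous (F : pt -> {vspace V}) : Prop :=
  forall e : frame, basis_of fullv e -> forall x, UH x ->
    gap e (F y) (F x) @[y --> within UH (nbhs x)] --> (0 : R).

Definition gauge_frame (g : pt -> 'End(V)) (h : pt -> frame) (x : pt) : frame :=
  [tuple of map (g x) (h x)].

Definition gauge_space (g : pt -> 'End(V)) (F : pt -> {vspace V}) (x : pt) :
  {vspace V} := (g x @: F x)%VS.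

Record invariant_splitting (k : nat) (Phi : R -> pt -> 'End(V))
    (L P : pt -> {vspace V}) : Prop := InvariantSplitting {
  split_dim : forall x, UH x -> \dim (L x) = k;
  split_cap : forall x, UH x -> (L x :&: P x = 0)%VS;
  split_add : forall x, UH x -> (L x + P x = fullv)%VS;
  split_invL : forall t x, UH x -> (Phi t x @: L x = L (flow t x))%VS;
  split_invP : forall t x, UH x -> (Phi t x @: P x = P (flow t x))%VS }.

(* A Hoelder decomposition Li + Pi of the bundle, expressed in the
   trivialization g; h and L + P are transported there by g.  The last two
   clauses make Li + Pi an approximation of L + P.  They cannot be dropped:
   when \dim V = 3 and k = 1, a constant decomposition Li + Pi with Li inside P
   is compatible with every other condition for limit maps of arbitrarily bad
   modulus of continuity. *)
Record holder_splitting (k : nat) (g : pt -> 'End(V)) (h : pt -> frame)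
    (L P Li Pi : pt -> {vspace V}) (e1 H a : R) : Prop := HolderSplitting {
  hs_dim : forall x, UH x -> \dim (Li x) = k;
  hs_cap : forall x, UH x -> (Li x :&: Pi x = 0)%VS;
  hs_add : forall x, UH x -> (Li x + Pi x = fullv)%VS;
  hs_contL : gr_continuous Li;
  hs_contP : gr_continuous Pi;
  hs_angle : forall x, UH x ->
    (e1%:E < angle (gauge_frame g h x) (Li x) (Pi x))%E;
  hs_holderL : forall x y, UH x -> UH y ->
    gap (gauge_frame g h x) (Li x) (Li y) <= H * distUH x y `^ a;
  hs_holderP : forall x y, UH x -> UH y ->
    gap (gauge_frame g h x) (Pi x) (Pi y) <= H * distUH x y `^ a;
  hs_angleL : forall x, UH x ->
    (e1%:E < angle (gauge_frame g h x) (Li x) (gauge_space g P x))%E;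
  hs_angleP : forall x, UH x ->
    (e1%:E < angle (gauge_frame g h x) (gauge_space g L x) (Pi x))%E }.

(* (D + A, h) is a uniformly hyperbolic bundle of rank k whose flow-invariant
   decomposition is L + P. *)
Record uniformly_hyperbolic (k : nat) (A : pt -> {linear pt -> 'End(V)})
    (h : pt -> frame) (Phi : R -> pt -> 'End(V)) (L P : pt -> {vspace V}) :
    Prop := UniformlyHyperbolic {
  uh_conn : trivializable A;
  uh_frame : frame_field h;
  uh_lift : flow_lift A Phi;
  uh_bounded : exists M : R, forall x u, UH x ->
    normf (h (flow 1 x)) (Phi 1 x u) <= M * normf (h x) u /\
    normf (h (flow (-1) x)) (Phi (-1) x u) <= M * normf (h x) u;
  uh_splitting : invariant_splitting k Phi L P;
  uh_volume : exists w : pt -> ('I_(\dim {: V}) -> V) -> R,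
    [/\ forall x, UH x -> volume_form (w x),
        forall u, {within UH, continuous (fun x => w x u)},
        exists C : R, forall x, UH x -> `|w x (tnth (h x))| <= C
      & forall t x u, UH x ->
          w (flow t x) (fun i => Phi t x (u i)) = w x u];
  uh_dominated : exists B b : R, [/\ 0 < B, 0 < b &
    forall s x u v, 0 < s -> UH x -> u \in L x -> v \in P x ->
      u != 0 -> v != 0 ->
      normf (h (flow s x)) (Phi s x u) / normf (h x) u <=
      B * expR (- b * s) *
        (normf (h (flow s x)) (Phi s x v) / normf (h x) v)];
  uh_angle : exists2 e0 : R, 0 < e0 &
    forall x F G, UH x -> closure_fibre h k L x F ->
      closure_fibre h (\dim {: V} - k)%N P x G ->
      ((2 * e0)%:E < angle (h x) F G)%E;
  uh_holder : exists g Li Pi, trivialization A g /\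
    exists e1 H a : R, [/\ 0 < e1, 0 < H, 0 < a &
      holder_splitting k g h L P Li Pi e1 H a] }.

(* Gr_k of the dual of V is identified with the Grassmannian of (dim V - k)-planes of V,
   so the dual limit map also takes values in {vspace V}. *)
Definition limit_map (g : pt -> 'End(V)) (L : pt -> {vspace V})
    (xi : R * R -> {vspace V}) : Prop :=
  forall y, UH y -> xi (fwd y) = gauge_space g L y.

Definition dual_limit_map (g : pt -> 'End(V)) (P : pt -> {vspace V})
    (xi : R * R -> {vspace V}) : Prop :=
  forall y, UH y -> xi (bwd y) = gauge_space g P y.

(* Euclidean structures on V all give bi-Lipschitz equivalent distances on the
   compact Grassmannians. *)
Definition holder_map (xi : R * R -> {vspace V}) : Prop :=
  forall e : frame, basis_of fullv e -> exists C a : R, [/\ 0 < a, a <= 1 &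
    forall s t, @circle R s -> @circle R t ->
      gap e (xi s) (xi t) <= C * `|s - t| `^ a].

End Bundle.

(* Main.v *)
(* In a trivialization, L and P are constant along the orbits of the geodesic
   flow. Write |.|_x for the norm of V given by the
   frame at x. The plane L^oo at flow n x is uniformly transverse to P, hence a
   graph over L of bounded slope in |.|_(flow n x); by domination its slope in
   |.|_x is O(exp(-b n)). Take x, y over a fixed base point with forward
   endpoints s, t: then flow n x and flow n y are at distance
   O(exp(n) |s - t|), the Hoelder bound for L^oo controls the gap of the two
   planes there, and the norms |.|_(flow n x), |.|_x differ by a factor at most
   M^n. The gap between L_x and L_y is therefore
   O(exp(-b n) + M^(2n) exp(a n) |s - t|^a), and one chooses n of order
   - log |s - t|. The bound for P is the same argument under time reversal. *)
Require Import Defs.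
From HB Require Import structures.
From mathcomp Require Import all_boot all_order all_algebra.
From mathcomp Require Import all_classical all_reals all_analysis.
From mathcomp Require Import ring lra.

Set Implicit Arguments.
Unset Strict Implicit.
Unset Printing Implicit Defensive.

Import Order.TTheory GRing.Theory Num.Theory numFieldNormedType.Exports.

Local Open Scope classical_set_scope.
Local Open Scope ring_scope.

Section FrameNorm.
Variables (R : realType) (V : vectType R).
Implicit Types (X Y : frame V) (F G K : {vspace V}) (u v w : V).

Lemma dotfC X u v : dotf X u v = dotf X v u.
Proof. by apply: eq_bigr => i _; rewrite mulrC. Qed.

Lemma dotfDl X u v w : dotf X (u + v) w = dotf X u w + dotf X v w.
Proof. by rewrite -big_split; apply: eq_bigr => i _; rewrite linearD mulrDl. Qed.

Lemma dotfZl X a u w : dotf X (a *: u) w = a * dotf X u w.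
Proof. by rewrite mulr_sumr; apply: eq_bigr => i _; rewrite linearZ mulrA. Qed.

Lemma dotfDr X u v w : dotf X w (u + v) = dotf X w u + dotf X w v.
Proof. by rewrite dotfC dotfDl !(dotfC _ w). Qed.

Lemma dotfZr X a u w : dotf X w (a *: u) = a * dotf X w u.
Proof. by rewrite dotfC dotfZl dotfC. Qed.

Lemma dotf_ge0 X u : 0 <= dotf X u u.
Proof. by apply: sumr_ge0 => i _; rewrite -expr2 sqr_ge0. Qed.

Lemma normf_ge0 X u : 0 <= normf X u.
Proof. exact: sqrtr_ge0. Qed.

Lemma sqr_normf X u : normf X u ^+ 2 = dotf X u u.
Proof. by rewrite sqr_sqrtr ?dotf_ge0. Qed.

Lemma normfZ X a u : normf X (a *: u) = `|a| * normf X u.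
Proof.
rewrite /normf dotfZl dotfZr mulrA -expr2 sqrtrM ?sqr_ge0 //.
by rewrite sqrtr_sqr.
Qed.

Lemma normf0 X : normf X 0 = 0.
Proof. by rewrite -(scale0r 0) normfZ normr0 mul0r. Qed.

Lemma normfN X u : normf X (- u) = normf X u.
Proof. by rewrite -scaleN1r normfZ normrN1 mul1r. Qed.

Lemma normfB X u v : normf X (u - v) = normf X (v - u).
Proof. by rewrite -normfN opprB. Qed.

Lemma coord_le_normf X i u : `|coord X i u| <= normf X u.
Proof.
rewrite -sqrtr_sqr ler_wsqrtr // /dotf (bigD1 i) //= -expr2 lerDl.
by apply: sumr_ge0 => j _; rewrite -expr2 sqr_ge0.
Qed.

Lemma normf_le_sum X u : normf X u <= \sum_i `|coord X i u|.
Proof.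
rewrite -(ler_pXn2r (n := 2)) ?nnegrE ?normf_ge0 ?sumr_ge0 //.
rewrite sqr_normf expr2 mulr_suml; apply: ler_sum => i _.
rewrite -expr2 -real_normK ?num_real // expr2 ler_wpM2l //.
by rewrite (bigD1 i) //= lerDl sumr_ge0.
Qed.

Lemma dotf_normf0 X u v : normf X v = 0 -> dotf X u v = 0.
Proof.
move=> v0; apply: big1 => i _.
suff -> : coord X i v = 0 by rewrite mulr0.
by apply/eqP; rewrite -normr_le0 -v0 coord_le_normf.
Qed.

Lemma dotf_le_normf X u v : `|dotf X u v| <= normf X u * normf X v.
Proof.
have [v0|v0] := eqVneq (normf X v) 0.
  by rewrite dotf_normf0 // normr0 v0 mulr0.
have vp : 0 < normf X v ^+ 2 by rewrite exprn_gt0 // lt_def v0 normf_ge0.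
rewrite -(ler_pXn2r (n := 2)) ?nnegrE ?mulr_ge0 ?normf_ge0 //.
rewrite real_normK ?num_real // exprMn.
have := dotf_ge0 X (normf X v ^+ 2 *: u - dotf X u v *: v).
rewrite -scaleNr !(dotfDl, dotfDr, dotfZl, dotfZr) (dotfC X v u) -!sqr_normf.
set a := normf X u; set b := dotf X u v; set c := normf X v ^+ 2 in vp *.
rewrite [leRHS](_ : _ = c * (a ^+ 2 * c - b ^+ 2)); last by ring.
by rewrite pmulr_rge0 // subr_ge0.
Qed.

Lemma ler_normfD X u v : normf X (u + v) <= normf X u + normf X v.
Proof.
rewrite -(ler_pXn2r (n := 2)) ?nnegrE ?addr_ge0 ?normf_ge0 //.
rewrite sqrrD !sqr_normf dotfDl !dotfDr (dotfC X v u) addrA.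
rewrite lerD2r -addrA lerD2l -mulr2n ler_pMn2r //.
exact: le_trans (ler_norm _) (dotf_le_normf _ _ _).
Qed.

Lemma normf_eq0 X u : basis_of fullv X -> (normf X u == 0) = (u == 0).
Proof.
move=> bX; apply/eqP/eqP => [u0|->]; last exact: normf0.
rewrite (coord_basis bX (memvf u)) big1 // => i _.
suff -> : coord X i u = 0 by rewrite scale0r.
by apply/eqP; rewrite -normr_le0 -u0 coord_le_normf.
Qed.

Lemma normf_gt0 X u : basis_of fullv X -> u != 0 -> 0 < normf X u.
Proof. by move=> bX u0; rewrite lt_def normf_eq0 // u0 normf_ge0. Qed.

Lemma angle_separation (e : R) : 0 < e -> exists2 K : R, 1 <= K &
  forall X F G, basis_of fullv X -> (e%:E < angle X F G)%E ->
  forall u v, u \in F -> v \in G ->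
    normf X u <= K * normf X (u + v) /\ normf X v <= K * normf X (u + v).
Proof.
move=> e0; pose c := cos e.
pose K := Num.sqrt (1 - c)^-1 + 1.
exists K; first by rewrite lerDr sqrtr_ge0.
have K1 : 1 <= K by rewrite lerDr sqrtr_ge0.
move=> X F G bX eFG u v uF vG.
have [->|u0] := eqVneq u 0.
  by rewrite normf0 add0r mulr_ge0 ?normf_ge0 ?(le_trans ler01) ?ler_peMl ?normf_ge0.
have [->|v0] := eqVneq v 0.
  by rewrite normf0 addr0 mulr_ge0 ?normf_ge0 ?(le_trans ler01) ?ler_peMl ?normf_ge0.
have up := normf_gt0 bX u0; have vp := normf_gt0 bX v0.
have key w : w \in G -> w != 0 -> dotf X u w < c * (normf X u * normf X w) /\ c < 1.
  move=> wG w0; have wp := normf_gt0 bX w0.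
  set r := dotf X u w / (normf X u * normf X w).
  have rI : -1 <= r <= 1.
    rewrite -ler_norml normrM normfV [X in _ / X]ger0_norm ?mulr_ge0 ?normf_ge0 //.
    by rewrite ler_pdivrMr ?mulr_gt0 // mul1r dotf_le_normf.
  have er : e < acos r.
    rewrite -lte_fin (lt_le_trans eFG) //; apply: ereal_inf_lbound.
    by exists u, w; split.
  have rpi := acos_lepi rI; have rge := acos_ge0 rI.
  have epi : e < pi by exact: lt_le_trans er rpi.
  split; last first.
    by rewrite -cos0 /c ltr_cos ?in_itv /= ?lexx ?pi_ge0 ?(ltW e0) ?(ltW epi).
  rewrite -ltr_pdivrMr ?mulr_gt0 // -/r.
  rewrite -[ltLHS]acosK ?in_itv //= /c ltr_cos ?in_itv /= ?rge ?rpi ?(ltW e0) //=.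
  exact: ltW.
have [] := key _ vG v0.
have [] := key (- v); rewrite ?memvN ?oppr_eq0 // normfN -scaleN1r dotfZr mulN1r.
move=> h1 c1 h2 _.
have uv : (1 - c) * (normf X u ^+ 2 + normf X v ^+ 2) <= normf X (u + v) ^+ 2.
  rewrite [leRHS]sqr_normf dotfDl !dotfDr (dotfC X v u) -!sqr_normf.
  move: h1 h2; set a := normf X u in up *; set b := normf X v in vp *.
  set d := dotf X u v => h1 h2.
  have c0 : 0 < c * (a * b) by lra.
  have c0' : 0 < c by move: c0; rewrite pmulr_lgt0 // mulr_gt0.
  have := sqr_ge0 (a - b); rewrite sqrrB => /(mulr_ge0 (ltW c0')).
  rewrite -mulr_natl; nra.
have sK : (1 - c)^-1 <= K ^+ 2.
  rewrite /K; set s := Num.sqrt _.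
  have s0 : 0 <= s by exact: sqrtr_ge0.
  have <- : s ^+ 2 = (1 - c)^-1 by rewrite sqr_sqrtr // invr_ge0 subr_ge0 ltW.
  nra.
have c1' : 0 < 1 - c by rewrite subr_gt0.
have K0 : 0 <= K by exact: le_trans K1.
have sq w : normf X w ^+ 2 <= normf X u ^+ 2 + normf X v ^+ 2 ->
    normf X w <= K * normf X (u + v).
  move=> wle; rewrite -(ler_pXn2r (n := 2)) ?nnegrE ?mulr_ge0 ?normf_ge0 //.
  rewrite exprMn (le_trans wle) // (le_trans _ (ler_wpM2r (sqr_ge0 _) sK)) //.
  by rewrite mulrC ler_pdivlMr // mulrC.
by split; apply: sq; rewrite ?lerDl ?lerDr sqr_ge0.
Qed.

Definition near_sub X F G (c : R) : Prop :=
  forall u, u \in F -> exists2 v, v \in G & normf X (u - v) <= c * normf X u.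

Lemma near_sub_refl X F c : 0 <= c -> near_sub X F F c.
Proof. by move=> c0 u uF; exists u; rewrite // subrr normf0 mulr_ge0 ?normf_ge0. Qed.

Lemma near_subW X F G c d : c <= d -> near_sub X F G c -> near_sub X F G d.
Proof.
move=> cd nFG u uF; have [v vG uv] := nFG u uF.
by exists v => //; rewrite (le_trans uv) // ler_wpM2r ?normf_ge0.
Qed.

Lemma near_sub_trans X F G K c d : 0 <= d ->
  near_sub X F G c -> near_sub X G K d -> near_sub X F K (c + d * (1 + c)).
Proof.
move=> d0 nFG nGK u uF; have [v vG uv] := nFG u uF.
have [w wK vw] := nGK v vG; exists w => //.
have vu : normf X v <= (1 + c) * normf X u.
  rewrite -[X in normf _ X](subrK u v) (le_trans (ler_normfD _ _ _)) // normfB.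
  by rewrite mulrDl mul1r addrC lerD2l.
rewrite -(subrKA v u) (le_trans (ler_normfD _ _ _)) //.
by rewrite [leRHS]mulrDl lerD // (le_trans vw) // -mulrA ler_wpM2l.
Qed.

Lemma near_sub_change X Y F G (m m' c : R) : 0 <= m -> 0 <= c ->
  (forall u, normf Y u <= m * normf X u) ->
  (forall u, normf X u <= m' * normf Y u) ->
  near_sub X F G c -> near_sub Y F G (m * m' * c).
Proof.
move=> m0 c0 YX XY nFG u uF; have [v vG uv] := nFG u uF; exists v => //.
rewrite (le_trans (YX _)) // -!mulrA ler_wpM2l // (le_trans uv) //.
by rewrite mulrCA ler_wpM2l.
Qed.

Lemma half_gap_le X F G c : 0 <= c -> near_sub X F G c -> half_gap X F G <= c.
Proof.
move=> c0 nFG; rewrite /half_gap; set S := [set a | _].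
have [->|/set0P S0] := eqVneq S set0; first by rewrite sup0.
apply: ge_sup => // a [u [uF u1 ->]].
have [v vG] := nFG u uF; rewrite u1 mulr1; apply: le_trans.
apply: ge_inf; last by exists v.
by exists 0 => _ [w [_ ->]]; exact: normf_ge0.
Qed.

Lemma near_sub_half_gap X F G d c : basis_of fullv X ->
  half_gap X F G <= d -> d < c -> near_sub X F G c.
Proof.
move=> bX FGd dc u uF.
have [->|u0] := eqVneq u 0.
  by exists 0; rewrite ?mem0v // subrr normf0 mulr0.
have up := normf_gt0 bX u0.
have lb w : has_lbound [set b | exists v, v \in G /\ b = normf X (w - v)].
  by exists 0 => _ [v [_ ->]]; exact: normf_ge0.
pose w := (normf X u)^-1 *: u.
have w1 : normf X w = 1.
  by rewrite normfZ ger0_norm ?invr_ge0 ?normf_ge0 // mulVf ?gt_eqF.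
have : inf [set b | exists v, v \in G /\ b = normf X (w - v)] < c.
  apply: le_lt_trans dc; apply: le_trans FGd; apply: ub_le_sup.
    exists 1 => _ [z [_ z1 ->]]; apply: ge_inf => //.
    by exists 0; rewrite mem0v subr0.
  by exists w; rewrite memvZ.
move=> /inf_lt[|_ [v [vG ->]] wv].
  by exists (normf X (w - 0)), 0; rewrite mem0v.
exists (normf X u *: v); first by rewrite memvZ.
have -> : u - normf X u *: v = normf X u *: (w - v).
  by rewrite scalerBr scalerA divff ?gt_eqF // scale1r.
by rewrite normfZ ger0_norm ?normf_ge0 // mulrC ler_wpM2r ?normf_ge0 // ltW.
Qed.

Lemma half_gap_ge0 X F G : 0 <= half_gap X F G.
Proof.
rewrite /half_gap; set S := [set a | _].
have [->|/set0P[a Sa]] := eqVneq S set0; first by rewrite sup0.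
have [u [uF u1 ae]] := Sa; have ha : 0 <= a.
  rewrite ae; apply: lb_le_inf; first by exists (normf X (u - 0)), 0; rewrite mem0v.
  by move=> _ [v [_ ->]]; exact: normf_ge0.
apply: le_trans ha _; apply: ub_le_sup => //; exists 1 => _ [z [_ z1 ->]].
apply: ge_inf; first by exists 0 => _ [v [_ ->]]; exact: normf_ge0.
by exists 0; rewrite mem0v subr0.
Qed.

Lemma half_gap_le1 X F G : half_gap X F G <= 1.
Proof.
apply: half_gap_le => // u uF; exists 0; first exact: mem0v.
by rewrite subr0 mul1r.
Qed.

Lemma half_gap_le_gap X F G : half_gap X F G <= gap X F G.
Proof. by rewrite /gap le_max lexx. Qed.

Lemma gapxx X F : gap X F F = 0.
Proof.
have h : half_gap X F F = 0.
  by apply/eqP; rewrite eq_le half_gap_ge0 half_gap_le //; exact: near_sub_refl.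
by rewrite /gap h maxxx.
Qed.

(* A complement of G transverse to it is a graph over F; the domination
   contracts the slope of this graph by the factor q. *)
Lemma near_sub_graph (X Y : frame V) F G Fi (K K' q : R) :
  0 <= K -> 0 <= K' -> 0 <= q -> basis_of fullv X ->
  (F + G)%VS = fullv -> (Fi + G)%VS = fullv ->
  (forall u v, u \in F -> v \in G -> normf X u <= K * normf X (u + v)) ->
  (forall w v, w \in Fi -> v \in G -> normf Y v <= K' * normf Y (w + v)) ->
  (forall u v, u \in F -> v \in G ->
    normf X v * normf Y u <= q * normf Y v * normf X u) ->
  basis_of fullv Y ->
  near_sub X F Fi (K' * q) /\ near_sub X Fi F (K * (K' * q)).
Proof.
move=> K0 K'0 q0 bX FG FiG FGK FiGK dom bY.
have main u v : u \in F -> v \in G -> u + v \in Fi ->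
    normf X v <= K' * q * normf X u.
  move=> uF vG wFi; have NvG : - v \in G by rewrite memvN.
  have := FiGK _ _ wFi NvG; rewrite addrK normfN => vu.
  have [u0|u0] := eqVneq u 0.
    move: vu; rewrite u0 normf0 mulr0 => v0; have : normf Y v == 0.
      by rewrite eq_le v0 normf_ge0.
    by rewrite normf_eq0 // => /eqP ->; rewrite !normf0 mulr0.
  have up := normf_gt0 bY u0.
  rewrite -(ler_pM2r up) (le_trans (dom _ _ uF vG)) //.
  rewrite -mulrA [leRHS](_ : _ = q * (K' * normf Y u * normf X u)); last by ring.
  by rewrite ler_wpM2l // ler_wpM2r ?normf_ge0.
split=> [u uF|w wFi].
  have : u \in (Fi + G)%VS by rewrite FiG memvf.
  case/memv_addP=> w wFi [v vG uE]; exists w => //.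
  rewrite uE addrC addKr -uE -normfN main ?memvN // uE.
  by rewrite addrK.
have : w \in (F + G)%VS by rewrite FG memvf.
case/memv_addP=> u uF [v vG wE]; exists u => //.
have uw : normf X u <= K * normf X w by rewrite wE; exact: FGK.
have := main u v uF vG; rewrite -wE => /(_ wFi) vu.
have -> : w - u = v by rewrite wE addrC addKr.
rewrite (le_trans vu) // [leRHS](_ : _ = K' * q * (K * normf X w)); last by ring.
by rewrite ler_wpM2l ?mulr_ge0.
Qed.

End FrameNorm.

Section HolderCriterion.
Variables (R : realType) (V : vectType R).

Lemma scale_balance (a b lam d : R) : 0 < a -> 0 < b -> 0 < lam -> 0 < d < 1 ->
  exists n : nat,
    expR (- b * n.+1%:R) <= d `^ (a * b / (2 * lam)) /\
    expR (lam * n.+1%:R) * d `^ a <= expR lam * d `^ (a / 2).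
Proof.
move=> a0 b0 lam0 /andP[d0 d1].
have ld : ln d <= 0 by rewrite ln_le0 // ltW.
pose X := - (a / (2 * lam) * ln d).
have X0 : 0 <= X by rewrite oppr_ge0 mulr_ge0_le0 // divr_ge0 ?mulr_ge0 ?ltW.
exists (Num.truncn X); have /andP[nX Xn] := truncn_itv X0.
have dE y : d `^ y = expR (y * ln d) by rewrite /powR gt_eqF.
rewrite !dE -!expRD !ler_expR; split.
  rewrite (_ : a * b / (2 * lam) * ln d = - b * X); last by rewrite /X; ring.
  by rewrite ler_wnM2l ?oppr_le0 ?ltW.
have {}nX := ler_wpM2l (ltW lam0) nX.
have lX : lam * X = - (a / 2 * ln d) by rewrite /X; field; rewrite gt_eqF.
rewrite -addn1 natrD mulrDr mulr1; move: nX; rewrite lX; lra.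
Qed.

Lemma holder_criterion (F : R * R -> {vspace V})
    (Fi : nat -> R * R -> {vspace V}) (X : nat -> R * R -> frame V)
    (Y : R * R -> frame V) (C b M H S a : R) :
  0 <= C -> 0 < b -> 1 <= M -> 0 < H -> 0 < S -> 0 < a ->
  (forall n t, circle t -> basis_of fullv (X n t)) ->
  (forall n t, circle t ->
    near_sub (Y t) (F t) (Fi n.+1 t) (C * expR (- b * n.+1%:R)) /\
    near_sub (Y t) (Fi n.+1 t) (F t) (C * expR (- b * n.+1%:R))) ->
  (forall n t t', circle t -> circle t' ->
    half_gap (X n t) (Fi n t) (Fi n t') <=
    H * (S * expR n%:R * `|t - t'|) `^ a) ->
  (forall n t u, circle t ->
    normf (Y t) u <= M ^+ n * normf (X n t) u /\
    normf (X n t) u <= M ^+ n * normf (Y t) u) ->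
  (forall e : frame V, basis_of fullv e -> exists2 m : R, 0 <= m &
    forall t u, circle t ->
      normf e u <= m * normf (Y t) u /\ normf (Y t) u <= m * normf e u) ->
  holder_map F.
Proof.
move=> C0 b0 M1 H0 S0 a0 bX FFi gapFi XY Ye e be.
have [m m0 em] := Ye e be.
pose lam := 2 * ln M + a.
have lM : 0 <= ln M by exact: ln_ge0.
have lam0 : 0 < lam by rewrite /lam ltr_wpDl // mulr_ge0.
pose al := Num.min 1 (Num.min (a / 2) (a * b / (2 * lam))).
have al0 : 0 < al by rewrite !lt_min ltr01 !divr_gt0 ?mulr_gt0.
have al1 : al <= 1 by rewrite /al ge_min lexx.
pose k1 := m * m * C; pose k2 := m * m * (2 * H * S `^ a * expR lam).
have k10 : 0 <= k1 by rewrite !mulr_ge0.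
have k20 : 0 <= k2 by rewrite !mulr_ge0 ?powR_ge0 ?expR_ge0 // ltW.
pose k3 := k1 + k2 * (1 + k1); pose k4 := k3 + k1 * (1 + k3).
have k30 : 0 <= k3 by rewrite addr_ge0 // mulr_ge0 // addr_ge0.
have k40 : 0 <= k4 by rewrite addr_ge0 // mulr_ge0 // addr_ge0.
have k41 : 0 <= k4 + 1 by exact: addr_ge0.
have half t t' : circle t -> circle t' ->
    half_gap e (F t) (F t') <= (k4 + 1) * `|t - t'| `^ al.
  move=> ct ct'.
  have [->|tt'] := eqVneq t t'.
    have cp := mulr_ge0 k41 (powR_ge0 `|t' - t'| al).
    by apply: half_gap_le => //; exact: near_sub_refl.
  set d := `|t - t'|; have d0 : 0 < d by rewrite normr_gt0 subr_eq0.
  have [d1|d1] := leP 1 d.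
    rewrite (le_trans (half_gap_le1 _ _ _)) // -[leLHS]mulr1 ler_pM ?lerDr //.
    by rewrite -(powRr0 d) ler_powR // ltW.
  have d01 : 0 < d < 1 by rewrite d0.
  have [n [En Dn]] := scale_balance a0 b0 lam0 d01.
  set p := d `^ al.
  have p0 : 0 <= p by exact: powR_ge0.
  have p1 : p <= 1.
    by rewrite -(powRr0 d) ger_powR ?d0 ?ltW.
  have En' : expR (- b * n.+1%:R) <= p.
    by rewrite (le_trans En) // ger_powR ?d0 ?(ltW d1) // /al !ge_min lexx !orbT.
  have Dn' : expR (lam * n.+1%:R) * d `^ a <= expR lam * p.
    rewrite (le_trans Dn) // ler_wpM2l ?expR_ge0 // ger_powR ?d0 ?(ltW d1) //.
    by rewrite /al !ge_min lexx !orbT.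
  have m20 : 0 <= m * m by rewrite mulr_ge0.
  have n1 : near_sub e (F t) (Fi n.+1 t) (k1 * p).
    apply: near_subW (near_sub_change m0 _ (fun u => (em t u ct).1)
      (fun u => (em t u ct).2) (FFi n t ct).1).
      by rewrite /k1 -!mulrA !ler_wpM2l.
    by rewrite mulr_ge0 ?expR_ge0.
  have n3 : near_sub e (Fi n.+1 t') (F t') (k1 * p).
    apply: near_subW (near_sub_change m0 _ (fun u => (em t' u ct').1)
      (fun u => (em t' u ct').2) (FFi n t' ct').2).
      by rewrite /k1 -!mulrA !ler_wpM2l.
    by rewrite mulr_ge0 ?expR_ge0.
  have n2 : near_sub e (Fi n.+1 t) (Fi n.+1 t') (k2 * p).
    set g := H * (S * expR n.+1%:R * d) `^ a.
    have g0 : 0 < g by rewrite mulr_gt0 ?powR_gt0 ?mulr_gt0 ?expR_gt0.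
    have gg : g < 2 * g by rewrite mulr_natl mulr2n ltrDl.
    have g2 : 0 <= 2 * g by exact/ltW/mulr_gt0.
    have ng := near_sub_half_gap (bX _ _ ct) (gapFi n.+1 t t' ct ct') gg.
    have Mn : 0 <= M ^+ n.+1 by rewrite exprn_ge0 // (le_trans ler01).
    have nY := near_sub_change Mn g2
      (fun u => (XY n.+1 t u ct).1) (fun u => (XY n.+1 t u ct).2) ng.
    apply: near_subW (near_sub_change m0 _ (fun u => (em t u ct).1)
      (fun u => (em t u ct).2) nY); last first.
      exact: (mulr_ge0 (mulr_ge0 Mn Mn) g2).
    have -> : M ^+ n.+1 * M ^+ n.+1 * (2 * g) =
        2 * H * S `^ a * (expR (lam * n.+1%:R) * d `^ a).
      have -> : M ^+ n.+1 = expR (ln M * n.+1%:R).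
        by rewrite expRM_natr lnK // posrE (lt_le_trans ltr01).
      rewrite /g !powRM ?mulr_ge0 ?expR_ge0 ?ltW // -expRM.
      have -> : lam * n.+1%:R = ln M * n.+1%:R + ln M * n.+1%:R + n.+1%:R * a.
        by rewrite /lam; ring.
      by rewrite !expRD; ring.
    rewrite /k2 -!mulrA ler_wpM2l // ler_wpM2l // ler_wpM2l //.
    by rewrite ler_wpM2l ?(ltW H0) // ler_wpM2l ?powR_ge0.
  have k2p : 0 <= k2 * p by rewrite mulr_ge0.
  have k1p : 0 <= k1 * p by rewrite mulr_ge0.
  have n4 := near_sub_trans k1p (near_sub_trans k2p n1 n2) n3.
  have k1p1 : k1 * p <= k1 by rewrite ler_piMr.
  have k3p1 : k3 * p <= k3 by rewrite ler_piMr.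
  have le3 : k1 * p + k2 * p * (1 + k1 * p) <= k3 * p.
    rewrite /k3 [leRHS]mulrDl lerD2l mulrAC ler_wpM2r // ler_wpM2l //.
    by rewrite lerD2l.
  apply: half_gap_le; first exact: mulr_ge0.
  apply: near_subW n4; rewrite mulrDl mul1r.
  rewrite (@le_trans _ _ (k4 * p)) ?lerDl // /k4 [leRHS]mulrDl lerD //.
  rewrite mulrAC ler_wpM2r // ler_wpM2l // lerD2l.
  exact: le_trans le3 k3p1.
exists (k4 + 1), al; split => // t t' ct ct'.
by rewrite /gap ge_max half // distrC half.
Qed.

End HolderCriterion.

Section Curves.
Variable R : realType.
Implicit Types (p q : 'rV[R]_3) (x y : pt R) (s t : R).

Lemma is_derive_continuous (W : normedModType R) (f : R -> W) t df :
  is_derive t 1 f df -> {for t, continuous f}.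
Proof. by case=> /derivable1_diffP/differentiable_continuous. Qed.

Lemma is_derive_scalel (W : normedModType R) (f : R -> R) (a : W) t df :
  is_derive t 1 f df -> is_derive t 1 (fun s => f s *: a) (df *: a).
Proof.
case=> fd <-.
have cv : h^-1 *: (((fun s => f s *: a) \o shift t) (h *: 1) - f t *: a)
    @[h --> 0^'] --> 'D_1 f t *: a.
  apply: cvg_trans; last exact: cvgZr_tmp fd.
  by apply: near_eq_cvg; near=> h; rewrite /= -scalerBl scalerA.
split; first by apply/cvg_ex; exists ('D_1 f t *: a).
exact/cvg_lim.
Unshelve. all: by end_near. Qed.

Lemma is_derive_comb (W : normedModType R) (f g : R -> R) (a b d : W) t df dg :
  is_derive t 1 f df -> is_derive t 1 g dg ->
  is_derive t 1 (fun s => f s *: a + g s *: b + d) (df *: a + dg *: b).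
Proof.
move=> fd gd.
have h := is_deriveD (is_deriveD (is_derive_scalel a fd) (is_derive_scalel b gd))
  (is_derive_cst d t (1 : R)).
by apply: is_derive_eq h _; rewrite addr0.
Qed.

Lemma C1_curve_comb (f g f' g' : R -> R) (a b d : pt R) :
  (forall t, is_derive t 1 f (f' t)) -> (forall t, is_derive t 1 g (g' t)) ->
  continuous f' -> continuous g' ->
  (forall t, UH (f t *: a + g t *: b + d)) ->
  C1_curve (fun t => f t *: a + g t *: b + d) /\
  derive1 (fun t => f t *: a + g t *: b + d) = (fun t => f' t *: a + g' t *: b).
Proof.
move=> fd gd cf cg U.
have cd t := is_derive_comb a b d (fd t) (gd t).
have dE : derive1 (fun t => f t *: a + g t *: b + d) =
    (fun t => f' t *: a + g' t *: b).
  by apply/funext => t; rewrite derive1E; case: (cd t).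
split; last exact: dE.
split; [exact: U | by move=> t; case: (cd t) |].
rewrite dE => t.
exact: cvgD (cvgZr_tmp (cf t)) (cvgZr_tmp (cg t)).
Qed.

Lemma distUH_le (c : R -> pt R) (l : R) : C1_curve c ->
  (forall t, sasaki_norm (c t) (derive1 c t) = l) -> distUH (c 0) (c 1) <= l.
Proof.
move=> cC cl; apply: ge_inf.
  exists 0 => _ [c' [_ _ _ ->]]; apply: Rintegral_ge0 => t _; exact: sqrtr_ge0.
exists c; split => //; rewrite /curve_length.
under eq_Rintegral do rewrite cl.
rewrite Rintegral_cst //= lebesgue_measure_itv /= lte_fin ltr01.
by rewrite sube0 mulr1.
Qed.

Lemma lorC p q : lor p q = lor q p.
Proof. by rewrite /lor; ring. Qed.

Lemma lorDl p p' q : lor (p + p') q = lor p q + lor p' q.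
Proof. by rewrite /lor !mxE; ring. Qed.

Lemma lorZl s p q : lor (s *: p) q = s * lor p q.
Proof. by rewrite /lor !mxE; ring. Qed.

Lemma lorDr p p' q : lor q (p + p') = lor q p + lor q p'.
Proof. by rewrite /lor !mxE; ring. Qed.

Lemma lorZr s p q : lor q (s *: p) = s * lor q p.
Proof. by rewrite /lor !mxE; ring. Qed.

Lemma expRKN t : expR t * expR (- t) = 1.
Proof. by rewrite -expRD subrr expR0. Qed.

Lemma chD s t : ch (s + t) = ch s * ch t + sh s * sh t.
Proof. by rewrite /ch /sh opprD !expRD; field. Qed.

Lemma shD s t : sh (s + t) = sh s * ch t + ch s * sh t.
Proof. by rewrite /ch /sh opprD !expRD; field. Qed.

Lemma ch2Bsh2 t : ch t ^+ 2 - sh t ^+ 2 = 1.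
Proof. by rewrite -(expRKN t) /ch /sh; field. Qed.

Lemma ch_gt0 t : 0 < ch t.
Proof. by rewrite divr_gt0 // addr_gt0 ?expR_gt0. Qed.

Lemma ch0 : ch 0 = 1 :> R.
Proof. by rewrite /ch oppr0 expR0; field. Qed.

Lemma sh0 : sh 0 = 0 :> R.
Proof. by rewrite /sh oppr0 expR0 subrr mul0r. Qed.

Lemma ch_abs_sh t : `|sh t| < ch t.
Proof.
rewrite -(ltr_pXn2r (n := 2)) ?nnegrE ?(ltW (ch_gt0 _)) //.
by rewrite real_normK ?num_real // -subr_gt0 ch2Bsh2.
Qed.

Lemma is_derive_expRN t : is_derive t 1 (fun s => expR (- s)) (- expR (- t)).
Proof.
have h : is_derive t (1 : R) (expR \o -%R) (expR (- t) * -1) by exact: is_derive1_comp.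
by apply: is_derive_eq h _; rewrite mulrN1.
Qed.

Lemma is_derive_ch t : is_derive t 1 (@ch R) (sh t).
Proof.
have h := is_deriveZ (2^-1) (is_deriveD (is_derive_expR t) (is_derive_expRN t)).
have -> : @ch R = 2^-1 \*: (expR + (fun s => expR (- s))).
  by apply/funext => s; rewrite /ch mulrC.
by apply: is_derive_eq h _; rewrite /sh mulrC.
Qed.

Lemma is_derive_sh t : is_derive t 1 (@sh R) (ch t).
Proof.
have h := is_deriveZ (2^-1) (is_deriveB (is_derive_expR t) (is_derive_expRN t)).
have -> : @sh R = 2^-1 \*: (expR - (fun s => expR (- s))).
  by apply/funext => s; rewrite /sh mulrC.
by apply: is_derive_eq h _; rewrite /ch mulrC opprK.
Qed.

Lemma continuous_ch : continuous (@ch R).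
Proof. by move=> t; exact: is_derive_continuous (is_derive_ch t). Qed.

Lemma continuous_sh : continuous (@sh R).
Proof. by move=> t; exact: is_derive_continuous (is_derive_sh t). Qed.

Lemma flow0 x : flow 0 x = x.
Proof. by case: x => p v; rewrite /flow ch0 sh0 !scale0r !scale1r addr0 add0r. Qed.

Lemma flowD s t x : flow (s + t) x = flow s (flow t x).
Proof.
by rewrite /flow chD shD /=; congr pair; apply/rowP => i; rewrite !mxE; ring.
Qed.

Lemma UH_abs_lt x : UH x -> `|x.2 0 0| < x.1 0 0.
Proof.
case: x => p v /= [pp p0 pv vv].
rewrite -(ltr_pXn2r (n := 2)) ?nnegrE ?(ltW p0) // real_normK ?num_real //.
move: pp pv vv; rewrite /lor.
move: (p 0 0) (p 0 1) (p 0 2%:R) (v 0 0) (v 0 1) (v 0 2%:R) => a b c a' b' c'.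
move=> pp pv vv; have := sqr_ge0 (b * c' - c * b').
have : (a * a') ^+ 2 = (b * b' + c * c') ^+ 2 by congr (_ ^+ 2); lra.
have e1 : b ^+ 2 + c ^+ 2 = a ^+ 2 - 1 by rewrite !expr2; lra.
have e2 : b' ^+ 2 + c' ^+ 2 = a' ^+ 2 + 1 by rewrite !expr2; lra.
have : (b * b' + c * c') ^+ 2 + (b * c' - c * b') ^+ 2 =
   (b ^+ 2 + c ^+ 2) * (b' ^+ 2 + c' ^+ 2) by ring.
rewrite e1 e2 exprMn => h1 h2; lra.
Qed.

Lemma UH_flow t x : UH x -> UH (flow t x).
Proof.
move=> Ux; have av := UH_abs_lt Ux; case: x Ux av => p v /= [pp p0 pv vv] av.
have cs := ch2Bsh2 t.
split=> /=; rewrite ?(lorDl, lorDr, lorZl, lorZr) ?(lorC v p) ?pp ?pv ?vv.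
- by rewrite -[in RHS]cs; ring.
- rewrite !mxE; have c0 := ch_gt0 t; have sc := ch_abs_sh t.
  have : `|sh t * v 0 0| < ch t * p 0 0 by rewrite normrM ltr_pM.
  by rewrite ltr_norml => /andP[]; lra.
- by ring.
- by rewrite -[in RHS]cs; ring.
Qed.

Lemma flow_curve x :
  (fun t => flow t x) = (fun t => ch t *: x + sh t *: ((x.2, x.1) : pt R) + 0).
Proof. 
apply/funext => t; rewrite addr0.
by apply: injective_projections; rewrite //= addrC.
Qed.

Lemma C1_flow x : UH x -> C1_curve (fun t => flow t x).
Proof.
move=> Ux; rewrite flow_curve.
have U t : UH (ch t *: x + sh t *: ((x.2, x.1) : pt R) + 0).
  by move: (UH_flow t Ux); rewrite -[flow t x]/((fun t => flow t x) t) flow_curve.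
exact: (C1_curve_comb is_derive_ch is_derive_sh continuous_sh continuous_ch U).1.
Qed.

Definition row3 (a b c : R) : 'rV[R]_3 := \row_(i < 3) [:: a; b; c]`_i.

Lemma row3E (a b c : R) :
  (row3 a b c 0 0 = a) * (row3 a b c 0 1 = b) * (row3 a b c 0 2%:R = c).
Proof. by rewrite !mxE. Qed.

Lemma row3P p q :
  p 0 0 = q 0 0 -> p 0 1 = q 0 1 -> p 0 2%:R = q 0 2%:R -> p = q.
Proof.
move=> h0 h1 h2; apply/rowP => -[[|[|[|//]]] i3].
- by move: h0; congr (p _ _ = q _ _); exact: val_inj.
- by move: h1; congr (p _ _ = q _ _); exact: val_inj.
- by move: h2; congr (p _ _ = q _ _); exact: val_inj.
Qed.

Lemma chord_angle (th : R) : 0 <= th <= pi ->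
  th ^+ 2 <= 32 * (1 - cos th).
Proof.
move=> /andP[t0 tpi]; have p0 := pi_gt0 R.
pose y := th / 4; have thE : th = y + y + (y + y) by rewrite /y; field.
have y0 : 0 <= y by rewrite divr_ge0.
have ypi : y + y <= pi / 2 by move: tpi; rewrite thE; lra.
have half c : 0 <= c <= y -> 2^-1 <= cos c.
  move=> /andP[c0 cy].
  have : 0 <= cos (c + c) by apply: cos_ge0_pihalf; apply/andP; split; lra.
  have : 0 <= cos c by apply: cos_ge0_pihalf; apply/andP; split; lra.
  rewrite cosD; have := cos2Dsin2 c; nra.
have sy : y / 2 <= sin y.
  have [z zy] : exists2 z, z \in `[0, y] & sin y - sin 0 = cos z * (y - 0).
    apply: MVT_segment y0 (fun z _ => is_derive_sin z) _.
    by apply: continuous_subspaceT => z; exact: continuous_sin.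
  rewrite sin0 !subr0 => ->; rewrite mulrC ler_wpM2r //.
  by apply: half; move: zy; rewrite in_itv.
have cy : 2^-1 <= cos y by apply: half; rewrite y0 lexx.
have s2 : y / 2 <= sin (y + y) by rewrite sinD; nra.
have y20 : 0 <= y / 2 by rewrite divr_ge0.
have := ler_pM y20 y20 s2 s2.
rewrite thE cosD; have := cos2Dsin2 (y + y); rewrite !expr2; lra.
Qed.


Lemma chord_le_angle (c d : R) : c ^+ 2 + d ^+ 2 = 1 ->
  exists th, [/\ c = cos th, d = sin th & th ^+ 2 <= 32 * (1 - c)].
Proof.
move=> cd.
have cI : -1 <= c <= 1.
  rewrite -ler_norml -(ler_pXn2r (n := 2)) ?nnegrE // expr1n.
  by rewrite real_normK ?num_real // -cd lerDl sqr_ge0.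
have cc : cos (acos c) = c by rewrite acosK // in_itv.
have th2 : acos c ^+ 2 <= 32 * (1 - c).
  by rewrite -[X in 1 - X]cc chord_angle // acos_ge0 // acos_lepi.
have : sin (acos c) ^+ 2 = d ^+ 2.
  by apply: (addrI (c ^+ 2)); rewrite cd -{1}cc cos2Dsin2.
move=> /eqP; rewrite eqf_sqr => /orP[/eqP sd|/eqP sd].
  by exists (acos c); rewrite cc sd.
by exists (- acos c); rewrite cosN sinN sqrrN cc sd opprK.
Qed.

Lemma circle_angle (s : R * R) : circle s -> exists th, s = (cos th, sin th).
Proof.
case: s => a b ab; have [th [ca sb _]] := chord_le_angle ab.
by exists th; rewrite -ca -sb.
Qed.

Definition orig : 'rV[R]_3 := row3 1 0 0.

Definition dir (s : R * R) : 'rV[R]_3 := row3 0 s.1 s.2.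

Definition base_pt (e : R) (s : R * R) : pt R := (orig, e *: dir s).

Lemma UH_base_pt e (s : R * R) : e ^+ 2 = 1 -> circle s -> UH (base_pt e s).
Proof.
rewrite /circle /= => e1 s1; split => /=; rewrite ?(lorZl, lorZr) /lor !row3E //.
- by ring.
- by ring.
- by rewrite mulr0 subr0 -!expr2 s1 mulr1 -expr2.
Qed.

Lemma fwd_base_pt (s : R * R) : fwd (base_pt 1 s) = s.
Proof.
case: s => a b; rewrite /fwd /ray /= !scale1r /orig /dir.
by rewrite !mxE /= !(add0r, addr0, divr1).
Qed.

Lemma bwd_base_pt (s : R * R) : bwd (base_pt (-1) s) = s.
Proof.
case: s => a b; rewrite /bwd /ray /= !scaleN1r opprK /orig /dir.
by rewrite !mxE /= !(add0r, addr0, divr1).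
Qed.

Lemma is_derive_rotation (w t : R) :
  is_derive t 1 (fun r => cos (r * w)) (- (w * sin (t * w))) /\
  is_derive t 1 (fun r => sin (r * w)) (w * cos (t * w)).
Proof.
have h : is_derive t (1 : R) (fun r => r * w) w.
  have := is_deriveZ w (is_derive_id t (1 : R)).
  rewrite (_ : w \*: id = (fun r => r * w)) => [h|].
    by apply: is_derive_eq h _; rewrite /GRing.scale /= mulr1.
  by apply/funext => r; rewrite mulrC.
split.
  have := is_derive1_comp (g := fun r => r * w) (is_derive_cos (t * w)) h.
  by rewrite mulNr mulrC.
have := is_derive1_comp (g := fun r => r * w) (is_derive_sin (t * w)) h.
by rewrite mulrC.
Qed.

Lemma C1_rotation (w : R) (a b d : pt R) :
  (forall t, UH (cos (t * w) *: a + sin (t * w) *: b + d)) ->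
  let c := fun t => cos (t * w) *: a + sin (t * w) *: b + d in
  C1_curve c /\ derive1 c =
    (fun t => (- (w * sin (t * w))) *: a + (w * cos (t * w)) *: b).
Proof.
move=> U; apply: (C1_curve_comb _ _ _ _ U).
- by move=> t; exact: (is_derive_rotation w t).1.
- by move=> t; exact: (is_derive_rotation w t).2.
- move=> t; apply: cvgN; apply: cvgM; first exact: cvg_cst.
  exact: is_derive_continuous (is_derive_rotation w t).2.
- move=> t; apply: cvgM; first exact: cvg_cst.
  exact: is_derive_continuous (is_derive_rotation w t).1.
Qed.

Lemma ch2Dsh2_le t : ch t ^+ 2 + sh t ^+ 2 <= expR `|t| ^+ 2.
Proof.
have h1 : expR t <= expR `|t| by rewrite ler_expR ler_norm.
have h2 : expR (- t) <= expR `|t| by rewrite ler_expR -normrN ler_norm.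
have h3 := ler_pM (expR_ge0 _) (expR_ge0 _) h1 h1.
have h4 := ler_pM (expR_ge0 _) (expR_ge0 _) h2 h2.
rewrite /ch /sh expr2; move: h3 h4.
set a := expR t; set b := expR (- t) => h3 h4.
rewrite (_ : _ + _ = (a * a + b * b) / 2); last by field.
lra.
Qed.

Lemma distUH_flow_base_pt (e t : R) (s s' : R * R) :
  e ^+ 2 = 1 -> circle s -> circle s' ->
  distUH (flow t (base_pt e s)) (flow t (base_pt e s')) <=
  6 * expR `|t| * `|s - s'|.
Proof.
case: s => x y; case: s' => x' y' e1 cs cs'.
have xy : x ^+ 2 + y ^+ 2 = 1 by exact: cs.
have xy' : x' ^+ 2 + y' ^+ 2 = 1 by exact: cs'.
have cd : (x * x' + y * y') ^+ 2 + (x * y' - y * x') ^+ 2 = 1.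
  transitivity ((x ^+ 2 + y ^+ 2) * (x' ^+ 2 + y' ^+ 2)); first by ring.
  by rewrite xy xy' mulr1.
have [w [cw sw w2]] := chord_le_angle cd.
pose a : pt R := (sh t *: (e *: dir (x, y)), ch t *: (e *: dir (x, y))).
pose b : pt R := (sh t *: (e *: dir (- y, x)), ch t *: (e *: dir (- y, x))).
pose d : pt R := (ch t *: orig, sh t *: orig).
pose c r := cos (r * w) *: a + sin (r * w) *: b + d.
pose rho r := (cos (r * w) * x - sin (r * w) * y, cos (r * w) * y + sin (r * w) * x).
have cE r : c r = flow t (base_pt e (rho r)).
  by apply: injective_projections; apply: row3P; rewrite /= !mxE /=; ring.
have crho r : circle (rho r).
  rewrite /circle /rho /=.
  transitivity ((cos (r * w) ^+ 2 + sin (r * w) ^+ 2) * (x ^+ 2 + y ^+ 2)).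
    by ring.
  by rewrite cos2Dsin2 xy mulr1.
have U r : UH (c r) by rewrite cE; apply/UH_flow/UH_base_pt.
have [cC dc] := C1_rotation U.
have rho0 : rho 0 = (x, y).
  by rewrite /rho mul0r cos0 sin0; congr pair; ring.
have rho1 : rho 1 = (x', y').
  rewrite /rho mul1r -cw -sw; congr pair.
    by transitivity ((x ^+ 2 + y ^+ 2) * x'); [ring | rewrite xy mul1r].
  by transitivity ((x ^+ 2 + y ^+ 2) * y'); [ring | rewrite xy mul1r].
rewrite -rho0 -rho1 -!cE rho0 rho1.
pose l := Num.sqrt (w ^+ 2 * (ch t ^+ 2 + sh t ^+ 2)).
have := distUH_le (l := l) cC; rewrite -/c => /(_ _)/le_trans; apply.
  move=> r; rewrite dc /sasaki_norm /l; congr Num.sqrt.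
  have -> : lor ((- (w * sin (r * w))) *: a + (w * cos (r * w)) *: b).2 (c r).1 = 0.
    by rewrite /lor /= !mxE /=; ring.
  rewrite scale0r addr0 /lor /= !mxE /=.
  set C := cos _; set Sn := sin _.
  have h1 : C ^+ 2 + Sn ^+ 2 = 1 by exact: cos2Dsin2.
  transitivity (w ^+ 2 * (ch t ^+ 2 + sh t ^+ 2) *
    (e ^+ 2 * (C ^+ 2 + Sn ^+ 2) * (x ^+ 2 + y ^+ 2))); first by ring.
  by rewrite e1 h1 xy !mulr1.
rewrite /l -(ler_pXn2r (n := 2)) ?nnegrE ?sqrtr_ge0 ?mulr_ge0 ?expR_ge0 ?normr_ge0 //.
rewrite sqr_sqrtr; last by rewrite mulr_ge0 ?addr_ge0 ?sqr_ge0.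
rewrite [X in _ <= X ^+ 2]mulrAC [leRHS]exprMn.
apply: (ler_pM (sqr_ge0 w) (addr_ge0 (sqr_ge0 _) (sqr_ge0 _)) _ (ch2Dsh2_le t)).
apply: le_trans w2 _.
have n1 : `|x - x'| <= `|(x, y) - (x', y')|.
  by rewrite [leRHS]prod_normE le_max lexx.
have n2 : `|y - y'| <= `|(x, y) - (x', y')|.
  by rewrite [leRHS]prod_normE le_max lexx orbT.
have := ler_pM (normr_ge0 _) (normr_ge0 _) n1 n1.
have := ler_pM (normr_ge0 _) (normr_ge0 _) n2 n2.
rewrite -!expr2 !real_normK ?num_real //.
rewrite exprMn; have := sqr_ge0 `|(x, y) - (x', y')|.
move: (`|(x, y) - (x', y')| ^+ 2) => z z0 n1' n2'.
have -> : 1 - (x * x' + y * y') = ((x - x') ^+ 2 + (y - y') ^+ 2) / 2.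
  transitivity ((x ^+ 2 + y ^+ 2 + (x' ^+ 2 + y' ^+ 2)) / 2 - (x * x' + y * y')).
    by rewrite xy xy'; field.
  by field.
lra.
Qed.

End Curves.

Section Connectedness.
Variable R : realType.
Implicit Types (p q : 'rV[R]_3) (x y : pt R).

Definition rot3 (t : R) p : 'rV[R]_3 :=
  row3 (p 0 0) (cos t * p 0 1 - sin t * p 0 2%:R) (sin t * p 0 1 + cos t * p 0 2%:R).

Definition boost3 (t : R) p : 'rV[R]_3 :=
  row3 (ch t * p 0 0 + sh t * p 0 1) (sh t * p 0 0 + ch t * p 0 1) (p 0 2%:R).

Lemma lor_rot3 t p q : lor (rot3 t p) (rot3 t q) = lor p q.
Proof.
rewrite /lor !row3E.
transitivity ((cos t ^+ 2 + sin t ^+ 2) *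
  (p 0 1 * q 0 1 + p 0 2%:R * q 0 2%:R) - p 0 0 * q 0 0); first by ring.
by rewrite cos2Dsin2 mul1r.
Qed.

Lemma lor_boost3 t p q : lor (boost3 t p) (boost3 t q) = lor p q.
Proof.
rewrite /lor !row3E.
transitivity ((ch t ^+ 2 - sh t ^+ 2) * (p 0 1 * q 0 1 - p 0 0 * q 0 0) +
  p 0 2%:R * q 0 2%:R); first by ring.
by rewrite ch2Bsh2; ring.
Qed.

Lemma UH_rot3 t x : UH x -> UH (rot3 t x.1, rot3 t x.2).
Proof. by case=> pp p0 pv vv; split; rewrite /= ?lor_rot3 ?row3E. Qed.

Lemma UH_boost3 t x : UH x -> UH (boost3 t x.1, boost3 t x.2).
Proof.
case=> pp p0 pv vv; split; rewrite /= ?lor_boost3 //.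
have p1 : `|x.1 0 1| < x.1 0 0.
  rewrite -(ltr_pXn2r (n := 2)) ?nnegrE ?(ltW p0) // real_normK ?num_real //.
  by move: pp; rewrite /lor; have := sqr_ge0 (x.1 0 2%:R); rewrite !expr2; lra.
have : `|sh t * x.1 0 1| < ch t * x.1 0 0 by rewrite normrM ltr_pM // ch_abs_sh.
by rewrite row3E ltr_norml => /andP[]; lra.
Qed.

Lemma C1_rot3 x : UH x -> C1_curve (fun t => (rot3 t x.1, rot3 t x.2)).
Proof.
pose a q := row3 0 (q 0 1) (q 0 2%:R).
pose b q := row3 0 (- q 0 2%:R) (q 0 1).
pose d q := row3 (q 0 0) 0 0.
have cE : (fun t => (rot3 t x.1, rot3 t x.2)) =
    (fun t => cos (t * 1) *: ((a x.1, a x.2) : pt R) +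
      sin (t * 1) *: ((b x.1, b x.2) : pt R) + (d x.1, d x.2)).
  by apply/funext => t; rewrite mulr1; apply: injective_projections;
    apply: row3P; rewrite /= !mxE /=; ring.
move=> Ux; rewrite cE; apply: (C1_rotation _).1 => t.
have := UH_rot3 t Ux.
by rewrite -[(_, _)]/((fun t => (rot3 t x.1, rot3 t x.2)) t) cE.
Qed.

Lemma C1_boost3 x : UH x -> C1_curve (fun t => (boost3 t x.1, boost3 t x.2)).
Proof.
pose a q := row3 (q 0 0) (q 0 1) 0.
pose b q := row3 (q 0 1) (q 0 0) 0.
pose d q := row3 0 0 (q 0 2%:R).
have cE : (fun t => (boost3 t x.1, boost3 t x.2)) =
    (fun t => ch t *: ((a x.1, a x.2) : pt R) +
      sh t *: ((b x.1, b x.2) : pt R) + (d x.1, d x.2)).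
  by apply/funext => t; apply: injective_projections;
    apply: row3P; rewrite /= !mxE /=; ring.
move=> Ux; rewrite cE.
apply: (C1_curve_comb (@is_derive_ch R) (@is_derive_sh R)
  (@continuous_sh R) (@continuous_ch R) _).1 => t.
have := UH_boost3 t Ux.
by rewrite -[(_, _)]/((fun t => (boost3 t x.1, boost3 t x.2)) t) cE.
Qed.

Lemma exists_rot3 p : exists t, rot3 t p 0 2%:R = 0 /\ 0 <= rot3 t p 0 1.
Proof.
pose r := Num.sqrt (p 0 1 ^+ 2 + p 0 2%:R ^+ 2).
have rr : r ^+ 2 = p 0 1 ^+ 2 + p 0 2%:R ^+ 2.
  by rewrite sqr_sqrtr // addr_ge0 ?sqr_ge0.
have [r0|r0] := eqVneq r 0.
  move/eqP: rr; rewrite r0 expr0n eq_sym paddr_eq0 ?sqr_ge0 // !sqrf_eq0.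
  by case/andP=> /eqP p1 /eqP p2; exists 0; rewrite !row3E p1 p2 !mulr0 addr0 subr0.
have cr : circle (p 0 1 / r, - p 0 2%:R / r).
  rewrite /circle /=; transitivity ((p 0 1 ^+ 2 + p 0 2%:R ^+ 2) / r ^+ 2).
    by field.
  by rewrite -rr divff // sqrf_eq0.
have [t [ct st]] := circle_angle cr; exists t; rewrite !row3E -ct -st.
split; first by field.
rewrite (_ : _ - _ = (p 0 1 ^+ 2 + p 0 2%:R ^+ 2) / r); last by field.
by rewrite -rr divr_ge0 ?sqr_ge0 ?sqrtr_ge0.
Qed.

(* Every point is moved to a fixed one by a rotation about the origin, a boost
   and a second rotation. *)
Lemma UH_constant (T : Type) (f : pt R -> T) :
  (forall c, C1_curve c -> forall s t, f (c s) = f (c t)) ->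
  forall x y, UH x -> UH y -> f x = f y.
Proof.
move=> fc; suff h x : UH x -> f x = f (orig R, row3 0 1 0).
  by move=> x y /h -> /h ->.
have rot0 p : rot3 0 p = p by apply: row3P; rewrite row3E ?cos0 ?sin0; ring.
have boost0 p : boost3 0 p = p by apply: row3P; rewrite row3E ?ch0 ?sh0; ring.
have frot t z : UH z -> f z = f (rot3 t z.1, rot3 t z.2).
  by move=> Uz; rewrite -(fc _ (C1_rot3 Uz) 0 t) !rot0; case: z Uz.
have fboost t z : UH z -> f z = f (boost3 t z.1, boost3 t z.2).
  by move=> Uz; rewrite -(fc _ (C1_boost3 Uz) 0 t) !boost0; case: z Uz.
have at_orig z : UH z -> z.1 = orig R -> f z = f (orig R, row3 0 1 0).
  case: z => p v Uz /= pE; have [t [t2 t1]] := exists_rot3 v.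
  rewrite (frot t _ Uz) /= pE; congr (f (_, _)).
    by apply: row3P; rewrite !row3E; ring.
  have := UH_rot3 t Uz; rewrite /= pE => -[/= _ _ ov vv].
  have v0 : rot3 t v 0 0 = 0 by move: ov; rewrite /lor !row3E; lra.
  have v1 : rot3 t v 0 1 = 1.
    apply/eqP; rewrite -(eqrXn2 (n := 2)) // expr1n.
    by move: vv; rewrite /lor v0 t2 !mulr0 subr0 addr0 -expr2 => ->.
  by apply: row3P; rewrite ?v0 ?v1 ?t2 row3E.
move=> Ux; have [t [t2 _]] := exists_rot3 x.1.
rewrite (frot t _ Ux); have := UH_rot3 t Ux; set y := (_, _) => Uy.
have [yy y0 _ _] := Uy; have {}t2 : y.1 0 2%:R = 0 by exact: t2.
clearbody y; set a := y.1 0 0 in y0 *; set b := y.1 0 1.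
have ab : (a - b) * (a + b) = 1 by move: yy; rewrite /lor t2 -/a -/b; lra.
have ab0 : 0 < a + b.
  have : 0 <= (a - b) ^+ 2 + (a + b) ^+ 2 by rewrite addr_ge0 ?sqr_ge0.
  by nra.
pose w := - ln (a + b).
have eN : expR (- w) = a + b by rewrite opprK lnK // posrE.
have eP : expR w = a - b.
  rewrite expRN lnK ?posrE //; apply: (mulIf (lt0r_neq0 ab0)).
  by rewrite ab mulVf // gt_eqF.
have cw : ch w = a by rewrite /ch eN eP; field.
have sw : sh w = - b by rewrite /sh eN eP; field.
rewrite (fboost w _ Uy); apply: at_orig (UH_boost3 w Uy) _ => /=.
apply: row3P; rewrite !row3E ?cw ?sw -/a -/b ?t2 //.
  by transitivity ((a - b) * (a + b)); [ring | exact: ab].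
by ring.
Qed.

End Connectedness.

Section FrameLimits.
Variables (R : realType) (V : vectType R).
Implicit Types (X Y : frame V) (u v w : V).

Lemma cvg_bigD (T : Type) (F : set_system T) (FF : Filter F) (I : Type)
    (r : seq I) (P : pred I) (f : I -> T -> R) (a : I -> R) :
  (forall i, P i -> f i x @[x --> F] --> a i) ->
  \sum_(i <- r | P i) f i x @[x --> F] --> \sum_(i <- r | P i) a i.
Proof.
move=> fa; elim: r => [|i r IHr].
  by under eq_fun do rewrite big_nil; rewrite big_nil; exact: cvg_cst.
under eq_fun do rewrite big_cons; rewrite big_cons.
by case: ifPn => // Pi; apply: cvgD => //; exact: fa.
Qed.

Lemma cvg_bigM (T : Type) (F : set_system T) (FF : Filter F) (I : Type)
    (r : seq I) (P : pred I) (f : I -> T -> R) (a : I -> R) :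
  (forall i, P i -> f i x @[x --> F] --> a i) ->
  \prod_(i <- r | P i) f i x @[x --> F] --> \prod_(i <- r | P i) a i.
Proof.
move=> fa; elim: r => [|i r IHr].
  by under eq_fun do rewrite big_nil; rewrite big_nil; exact: cvg_cst.
under eq_fun do rewrite big_cons; rewrite big_cons.
by case: ifPn => // Pi; apply: cvgM => //; exact: fa.
Qed.

Lemma cvg_det (T : Type) (F : set_system T) (FF : Filter F) n
    (M : T -> 'M[R]_n) (N : 'M[R]_n) :
  (forall i j, M x i j @[x --> F] --> N i j) -> \det (M x) @[x --> F] --> \det N.
Proof.
move=> MN; apply: cvg_bigD => s _; apply: cvgM; first exact: cvg_cst.
by apply: cvg_bigM => i _; exact: MN.
Qed.

Lemma cvg_invmx (T : Type) (F : set_system T) (FF : Filter F) n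
    (M : T -> 'M[R]_n) (N : 'M[R]_n) i j :
  (forall x, M x \in unitmx) -> N \in unitmx ->
  (forall i j, M x i j @[x --> F] --> N i j) ->
  invmx (M x) i j @[x --> F] --> invmx N i j.
Proof.
move=> uM uN MN.
have E (A : 'M[R]_n) : A \in unitmx -> invmx A i j = (\det A)^-1 * cofactor A j i.
  by move=> uA; rewrite /invmx uA !mxE.
under eq_fun do rewrite E //; rewrite E //; apply: cvgM.
  by apply: cvgV; [rewrite -unitfE -unitmxE | exact: cvg_det].
apply: cvgM; first exact: cvg_cst.
by apply: cvg_det => k l; under eq_fun do rewrite !mxE; rewrite !mxE; exact: MN.
Qed.

Lemma coord_sum_tnth X u : basis_of fullv X -> u = \sum_i coord X i u *: tnth X i.
Proof.
move=> bX; rewrite {1}(coord_basis bX (memvf u)); apply: eq_bigr => i _.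
by rewrite (tnth_nth 0).
Qed.

Lemma coord_change X Y j u : basis_of fullv X ->
  coord Y j u = \sum_i coord X i u * coord Y j (tnth X i).
Proof.
move=> bX; rewrite {1}(coord_sum_tnth u bX) linear_sum; apply: eq_bigr => i _.
by rewrite linearZ.
Qed.

Lemma coord_tnth X i j : basis_of fullv X -> coord X j (tnth X i) = (i == j)%:R.
Proof.
by move=> bX; rewrite (tnth_nth 0) coord_free ?(basis_free bX) // eq_sym.
Qed.

Lemma cvg_coord (T : Type) (F : set_system T) (FF : Filter F)
    (X : T -> frame V) (Y : frame V) i w :
  (forall x, basis_of fullv (X x)) -> basis_of fullv Y ->
  (forall i (l : 'Hom(V, R^o)),
    (l (tnth (X x) i) : R) @[x --> F] --> (l (tnth Y i) : R)) ->
  coord (X x) i w @[x --> F] --> coord Y i w.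
Proof.
move=> bX bY XY; pose b := vbasis (fullv : {vspace V}).
have bb : basis_of fullv b := vbasisP _.
pose M (Z : frame V) := \matrix_(k, j) coord b j (tnth Z k).
have MN (Z : frame V) : basis_of fullv Z ->
    (\matrix_(k, j) coord Z j (tnth b k)) *m M Z = 1%:M.
  move=> bZ; apply/matrixP => k j; rewrite !mxE -(coord_tnth k j bb).
  by rewrite (coord_change b j _ bZ); apply: eq_bigr => m _; rewrite !mxE.
have uM (Z : frame V) : basis_of fullv Z -> M Z \in unitmx.
  by move=> bZ; case/mulmx1_unit: (MN Z bZ).
have E (Z : frame V) : basis_of fullv Z ->
    coord Z i w = \sum_j coord b j w * invmx (M Z) j i.
  move=> bZ; rewrite (coord_change Z i w bb); apply: eq_bigr => j _.
  have /(congr1 (mulmx^~ (invmx (M Z)))) := MN Z bZ.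
  by rewrite mulmxK ?uM // mul1mx => <-; rewrite mxE.
under eq_fun do rewrite E //; rewrite E //.
apply: cvg_bigD => j _; apply: cvgM; first exact: cvg_cst.
apply: (@cvg_invmx _ F _ _ (fun x => M (X x))) => [x||k m]; rewrite ?uM //.
under eq_fun do rewrite mxE; rewrite mxE.
have := XY k (linfun (coord b m)); under eq_fun do rewrite lfunE.
by rewrite lfunE.
Qed.

Lemma normf_change X Y (m : R) : 0 <= m -> basis_of fullv X ->
  (forall i j, `|coord Y j (tnth X i)| <= m) ->
  forall u, normf Y u <= (\dim {: V} ^ 2)%:R * m * normf X u.
Proof.
move=> m0 bX mm u; rewrite (le_trans (normf_le_sum _ _)) //.
apply: (@le_trans _ _ (\sum_(j < \dim {: V}) \sum_(i < \dim {: V}) m * normf X u)).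
  apply: ler_sum => j _; rewrite (coord_change Y j u bX).
  rewrite (le_trans (ler_norm_sum _ _ _)) //; apply: ler_sum => i _.
  by rewrite normrM mulrC ler_pM // coord_le_normf.
rewrite !sumr_const !card_ord -mulrnA -mulnn.
by rewrite -mulrA mulr_natl.
Qed.

Definition image_frame (f : 'End(V)) X : frame V := [tuple of map f X].

Lemma tnth_image_frame f X i : tnth (image_frame f X) i = f (tnth X i).
Proof. exact: tnth_map. Qed.

Lemma basis_image_frame f X :
  lker f = 0%VS -> basis_of fullv X -> basis_of fullv (image_frame f X).
Proof.
move=> kf bX; have := limg_basis_of _ bX => /(_ V f).
rewrite kf capv0 => /(_ (erefl _)).
by rewrite lker0_limgf // kf.
Qed.

Lemma coord_image_frame f X i u : lker f = 0%VS -> basis_of fullv X ->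
  coord (image_frame f X) i (f u) = coord X i u.
Proof.
move=> kf bX; have bfX := basis_image_frame kf bX.
rewrite {1}(coord_sum_tnth u bX) linear_sum linear_sum (bigD1 i) //= big1.
  by rewrite linearZ linearZ /= -tnth_image_frame coord_tnth // eqxx addr0 [LHS]mulr1.
move=> j ji; rewrite linearZ linearZ /= -tnth_image_frame coord_tnth //.
by rewrite (negPf ji) [LHS]mulr0.
Qed.

Lemma dotf_image_frame f X u v : lker f = 0%VS -> basis_of fullv X ->
  dotf (image_frame f X) (f u) (f v) = dotf X u v.
Proof. by move=> kf bX; apply: eq_bigr => i _; rewrite !coord_image_frame. Qed.

Lemma normf_image_frame f X u : lker f = 0%VS -> basis_of fullv X ->
  normf (image_frame f X) (f u) = normf X u.
Proof. by move=> kf bX; rewrite /normf dotf_image_frame. Qed.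

Lemma cvg_apply (T : Type) (F : set_system T) (FF : Filter F)
    (G : T -> 'End(V)) (s : T -> V) (G0 : 'End(V)) (s0 : V) (l : 'Hom(V, R^o)) :
  (forall u (l : 'Hom(V, R^o)), (l (G x u) : R) @[x --> F] --> (l (G0 u) : R)) ->
  (forall l : 'Hom(V, R^o), (l (s x) : R) @[x --> F] --> (l s0 : R)) ->
  (l (G x (s x)) : R) @[x --> F] --> (l (G0 s0) : R).
Proof.
move=> GG ss; pose b := vbasis (fullv : {vspace V}).
have bb : basis_of fullv b := vbasisP _.
have E (H : 'End(V)) v : l (H v) = \sum_i coord b i v * (l (H (tnth b i)) : R).
  rewrite {1}(coord_sum_tnth v bb) !linear_sum; apply: eq_bigr => i _.
  by rewrite !linearZ.
under eq_fun do rewrite E; rewrite E.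
apply: cvg_bigD => i _; apply: cvgM; last exact: GG.
have := ss (linfun (coord b i)); under eq_fun do rewrite lfunE.
by rewrite lfunE.
Qed.

Lemma is_derive_apply (G : R -> 'End(V)) (s : R -> V) (dG : 'End(V)) (ds : V) t
    (l : 'Hom(V, R^o)) :
  (forall u (l : 'Hom(V, R^o)),
    is_derive t (1 : R) (fun r => l (G r u) : R) (l (dG u))) ->
  (forall l : 'Hom(V, R^o), is_derive t (1 : R) (fun r => l (s r) : R) (l ds)) ->
  is_derive t (1 : R) (fun r => l (G r (s r)) : R) (l (dG (s t) + G t ds)).
Proof.
move=> GG ss; pose b := vbasis (fullv : {vspace V}).
have bb : basis_of fullv b := vbasisP _.
have E (H : 'End(V)) v : l (H v) = \sum_i coord b i v * (l (H (tnth b i)) : R).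
  rewrite {1}(coord_sum_tnth v bb) !linear_sum; apply: eq_bigr => i _.
  by rewrite !linearZ.
have cs i : is_derive t (1 : R) (fun r => coord b i (s r)) (coord b i ds).
  by have := ss (linfun (coord b i)); rewrite lfunE; under eq_fun do rewrite lfunE.
have h := is_derive_sum (fun i => is_deriveM (cs i) (GG (tnth b i) l)).
have -> : (fun r => l (G r (s r)) : R) =
    \sum_(i < \dim {: V})
      (fun r => coord b i (s r)) * (fun r => l (G r (tnth b i)) : R).
  by apply/funext => r; rewrite E fct_sumE.
apply: is_derive_eq h _.
have -> : l (dG (s t) + G t ds) = (l (dG (s t)) : R) + l (G t ds).
  exact: linearD.
rewrite !E -big_split; apply: eq_bigr => i _ /=.
by congr (_ + _); exact: mulrC.
Qed.

Lemma is_derive_mul0 (s q : R -> R) t : {for t, continuous s} -> q t = 0 ->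
  is_derive t (1 : R) q 0 -> is_derive t (1 : R) (s * q) 0.
Proof.
move=> cs qt [dq q0].
have cv : h^-1 *: (((s * q) \o shift t) (h *: (1 : R)) - (s * q) t)
    @[h --> 0^'] --> (0 : R).
  have sh : s (h *: (1 : R) + t) @[h --> 0^'] --> s t.
    have ht : h *: (1 : R) + t @[h --> 0^'] --> (0 : R) *: (1 : R) + t.
      by apply: cvgD (cvg_cst _); apply: cvgZr_tmp; exact: nbhs_dnbhs.
    rewrite scale0r add0r in ht; exact: (cvg_comp _ _ ht cs).
  have := cvgM sh dq; rewrite -/('D_1 q t) q0 mulr0 => sq0.
  apply: cvg_trans; last exact: sq0.
  apply: near_eq_cvg; near=> h.
  rewrite /= -[(s * q) t]/(s t * q t) qt mulr0 !subr0; exact: mulrCA.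
split; first by apply/cvg_ex; exists 0.
exact/cvg_lim.
Unshelve. all: by end_near. Qed.

Lemma is_derive_apply0 (G : R -> 'End(V)) (s : R -> V) t (l : 'Hom(V, R^o)) :
  G t = 0 ->
  (forall u (l : 'Hom(V, R^o)), is_derive t (1 : R) (fun r => l (G r u) : R) 0) ->
  (forall l : 'Hom(V, R^o), {for t, continuous (fun r => l (s r) : R)}) ->
  is_derive t (1 : R) (fun r => l (G r (s r)) : R) 0.
Proof.
move=> Gt GG ss; pose b := vbasis (fullv : {vspace V}).
have bb : basis_of fullv b := vbasisP _.
have -> : (fun r => l (G r (s r)) : R) =
    \sum_(i < \dim {: V})
      (fun r => coord b i (s r)) * (fun r => l (G r (tnth b i)) : R).
  apply/funext => r; rewrite fct_sumE {1}(coord_sum_tnth (s r) bb) !linear_sum.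
  by apply: eq_bigr => i _; rewrite !linearZ.
have h i : is_derive t (1 : R)
    ((fun r => coord b i (s r)) * (fun r => l (G r (tnth b i)) : R)) 0.
  have ci : {for t, continuous (fun r => coord b i (s r))}.
    have := ss (linfun (coord b i)).
    rewrite (_ : (fun r => _) = (fun r => coord b i (s r))) //.
    by apply/funext => r; rewrite lfunE.
  apply: (is_derive_mul0 ci _ (GG (tnth b i) l)).
  by rewrite Gt lfunE /= linear0.
by apply: is_derive_eq (is_derive_sum h) _; rewrite big1.
Qed.

End FrameLimits.

Section Gauge.
Variables (R : realType) (V : vectType R).
Implicit Types (x y : pt R) (u v w : V) (X Y : frame V).
Local Notation UH := (@UH R).

Lemma linear_form_eq u v : (forall l : 'Hom(V, R^o), l u = l v) -> u = v.
Proof.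
move=> luv; have bb := vbasisP (fullv : {vspace V}).
rewrite (coord_sum_tnth u bb) (coord_sum_tnth v bb); apply: eq_bigr => i _.
by have := luv (linfun (coord (vbasis fullv) i)); rewrite !lfunE /= => ->.
Qed.

Lemma gauge_parallel (A : pt R -> {linear pt R -> 'End(V)}) g c s :
  trivialization A g -> C1_curve c -> parallel A c s ->
  forall t t', g (c t) (s t) = g (c t') (s t').
Proof.
move=> [_ _ gA] cC par t t'; apply: linear_form_eq => l.
apply: (is_derive_0_is_cst (f := fun r => l (g (c r) (s r)) : R)) => r.
pose a := A (c r) (derive1 c r).
have := @is_derive_apply R V (fun r => g (c r)) s (g (c r) \o a)%VF (- a (s r)) r l.
rewrite lfunE /= -[g (c r) (a (s r)) + _]linearD subrr !linear0; apply.
  by move=> u l'; rewrite lfunE /=; exact: gA.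
by move=> l'; rewrite linearN; exact: par.
Qed.

Lemma trivialization_unique (A : pt R -> {linear pt R -> 'End(V)}) g g' :
  trivialization A g -> trivialization A g' ->
  exists2 T : 'End(V), lker T = 0%VS & forall x, UH x -> g' x = (T \o g x)%VF.
Proof.
move=> [kg cg gA] [kg' cg' gA']; pose f x := (g' x \o (g x)^-1)%VF.
have Kg x : UH x -> cancel (g x) (g x)^-1%VF.
  by move=> Ux; apply: lker0_lfunK; rewrite kg.
have Kg' x : UH x -> cancel (g x)^-1%VF (g x).
  by move=> Ux w; apply: lker0_lfunVK; rewrite kg.
have fconst c : C1_curve c -> forall s t, f (c s) = f (c t).
  move=> cC s t; have [Uc _ _] := cC; apply/lfunP => w; apply: linear_form_eq => l.
  apply: (is_derive_0_is_cst (f := fun r => l (f (c r) w) : R)) => {s t} t.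
  (* G vanishes at t together with its derivative, so only the continuity of
     g^-1 along c is needed. *)
  pose G r := (g' (c r) - (f (c t) \o g (c r)))%VF.
  have GE r u : G r u = g' (c r) u - f (c t) (g (c r) u).
    by rewrite add_lfunE opp_lfunE comp_lfunE.
  pose S r := (g (c r))^-1%VF w.
  have fE : (fun r => l (f (c r) w) : R) =
      (fun r => l (G r (S r)) : R) + cst (l (f (c t) w) : R).
    apply/funext => r; rewrite !fctE GE Kg' // linearB /= [f (c r)]/f.
    by rewrite comp_lfunE -/(S r) [RHS]subrK.
  have h : is_derive t (1 : R) (fun r => l (G r (S r)) : R) 0.
    apply: is_derive_apply0.
    - by apply/lfunP => u; rewrite GE /f comp_lfunE Kg // subrr lfunE.
    - move=> u l'; pose a := A (c t) (derive1 c t).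
      have := is_deriveB (gA' c cC t u l') (gA c cC t u (l' \o f (c t))%VF).
      have -> : (l' \o f (c t))%VF (g (c t) (a u)) = l' (g' (c t) (a u)).
        by rewrite comp_lfunE /f comp_lfunE Kg.
      rewrite subrr.
      rewrite (_ : (fun s => l' (g' (c s) u) : R) - _ = (fun r => l' (G r u) : R)) //.
      by apply/funext => r; rewrite !fctE GE comp_lfunE [RHS]linearB.
    - move=> l'; pose b := vbasis (fullv : {vspace V}).
      have bb : basis_of fullv b := vbasisP _.
      have E r : l' (S r) =
          \sum_i coord (image_frame (g (c r)) b) i w * (l' (tnth b i) : R).
        rewrite {1}(coord_sum_tnth (S r) bb) linear_sum; apply: eq_bigr => i _.
        by rewrite linearZ -[in RHS](Kg' (c r) (Uc r) w) coord_image_frame ?kg.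
      suff : (l' (S r) : R) @[r --> t] --> (l' (S t) : R) by [].
      under eq_fun do rewrite E; rewrite E.
      apply: cvg_bigD => i _; apply: cvgM; last exact: cvg_cst.
      apply: cvg_coord => [r||j m].
      + by apply: basis_image_frame; rewrite ?kg.
      + by apply: basis_image_frame; rewrite ?kg.
      + under eq_fun do rewrite tnth_image_frame; rewrite tnth_image_frame.
        exact: is_derive_continuous (gA c cC t _ m).
  rewrite fE.
  apply: is_derive_eq (is_deriveD h (is_derive_cst _ t (1 : R))) _.
  by rewrite addr0.
pose o := base_pt (1 : R) (1, 0).
have Uo : UH o by apply: UH_base_pt; rewrite /circle ?expr1n //= expr0n addr0 expr1n.
exists (f o).
  apply/eqP/lker0P => u v; rewrite !lfunE /=.
  have /eqP/lker0P injg' := kg' o Uo.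
  by move=> /injg' /(congr1 (g o)); rewrite !Kg'.
move=> x Ux; rewrite (UH_constant fconst Uo Ux).
by apply/lfunP => u; rewrite !lfunE /= lfunE /= Kg.
Qed.

Lemma basis_gauge_frame A g (h : pt R -> frame V) x :
  trivialization A g -> frame_field h -> UH x ->
  basis_of fullv (gauge_frame g h x).
Proof.
by move=> [kg _ _] [bh _] Ux; apply: basis_image_frame; [exact: kg | exact: bh].
Qed.

Lemma base_circle_compare A g (h : pt R -> frame V) (e : R) (E : frame V) :
  trivialization A g -> frame_field h -> e ^+ 2 = 1 -> basis_of fullv E ->
  exists2 m : R, 0 <= m & forall s u, circle s ->
    normf E u <= m * normf (gauge_frame g h (base_pt e s)) u /\
    normf (gauge_frame g h (base_pt e s)) u <= m * normf E u.
Proof.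
move=> triv hf e1 bE; have [kg cg _] := triv; have [bh ch] := hf.
pose p th : pt R := base_pt e (cos th, sin th).
have Up th : UH (p th) by apply: UH_base_pt => //; exact: cos2Dsin2.
pose X th := gauge_frame g h (p th).
have bX th : basis_of fullv (X th) by exact: basis_gauge_frame triv hf (Up th).
have cp : continuous p.
  pose a : pt R := (0, e *: row3 0 1 0); pose b : pt R := (0, e *: row3 0 0 1).
  have -> : p = (fun th => cos th *: a + sin th *: b + ((orig R, 0) : pt R)).
    apply/funext => th; apply: injective_projections; apply: row3P;
      rewrite /= !mxE /=; ring.
  move=> th; exact: is_derive_continuous
    (is_derive_comb a b _ (is_derive_cos th) (is_derive_sin th)).
have within (f : pt R -> R) : {within UH, continuous f} ->
    forall th, f (p r) @[r --> th] --> f (p th).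
  move=> /subspace_continuousP cf th; have := cf _ (Up th).
  apply: cvg_comp => U WU.
  have nU : nbhs th (fun r => UH (p r) -> U (p r)) := cp th _ WU.
  apply: (filterS _ nU) => r; apply; exact: Up.
have cX i (l : 'Hom(V, R^o)) th :
    (l (tnth (X r) i) : R) @[r --> th] --> (l (tnth (X th) i) : R).
  have E' r : tnth (X r) i = g (p r) (tnth (h (p r)) i) by exact: tnth_map.
  under eq_fun do rewrite E'; rewrite E'.
  apply: cvg_apply => [u m|m].
    exact: within (cg u m) th.
  exact: within (ch i m) th.
pose S th := \sum_i \sum_j (`|coord E j (tnth (X th) i)| + `|coord (X th) j (tnth E i)|).
have cS : continuous S.
  move=> th; apply: cvg_bigD => i _; apply: cvg_bigD => j _.
  apply: cvgD; apply: cvg_norm.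
    have := cX i (linfun (coord E j)) th; under eq_fun do rewrite lfunE.
    by rewrite lfunE.
  by apply: cvg_coord => // k l; exact: cX.
have [|c _ Sc] := @EVT_max R S (-8) 8 _ (continuous_subspaceT cS).
  by rewrite lerNl; lra.
have S0 th : 0 <= S th.
  by apply: sumr_ge0 => i _; apply: sumr_ge0 => j _; rewrite addr_ge0.
have Sij th i j : th \in `[(-8), 8] ->
    `|coord E j (tnth (X th) i)| <= S c /\ `|coord (X th) j (tnth E i)| <= S c.
  move=> thI; have : `|coord E j (tnth (X th) i)| + `|coord (X th) j (tnth E i)| <= S c.
    apply: le_trans (Sc th thI); rewrite /S (bigD1 i) //= (bigD1 j) //= -addrA lerDl.
    rewrite addr_ge0 //; apply: sumr_ge0 => k _; first by rewrite addr_ge0.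
    by apply: sumr_ge0 => l _; rewrite addr_ge0.
  by move=> le; split; apply: le_trans le; rewrite ?lerDl ?lerDr.
exists ((\dim {: V} ^ 2)%:R * S c); first by rewrite mulr_ge0.
move=> s u cs.
have [th [sE thI]] : exists th, s = (cos th, sin th) /\ th \in `[(-8), 8].
  case: s cs => x y cs; have [th [xE yE th2]] := chord_le_angle cs.
  exists th; rewrite -xE -yE; split => //.
  have x1 : -1 <= x by move: xE => /= ->; exact: cos_geN1.
  have th64 : th ^+ 2 <= 8 ^+ 2 by move: th2 => /=; lra.
  rewrite in_itv /= -ler_norml -(ler_pXn2r (n := 2)) ?nnegrE //.
  by rewrite real_normK ?num_real.
rewrite sE -/(p th) -/(X th).
split; apply: normf_change => // i j.
  exact: (Sij th i j thI).1.
exact: (Sij th i j thI).2.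
Qed.

End Gauge.

Section LimitMaps.
Variables (R : realType) (V : vectType R).
Implicit Types (x y z : pt R) (u v w : V) (F G : {vspace V}).
Local Notation UH := (@UH R).

Lemma distUH_ge0 x y : 0 <= distUH x y.
Proof.
rewrite /distUH; set S := [set l | _].
have [->|/set0P S0] := eqVneq S set0; first by rewrite inf0.
apply: lb_le_inf => // _ [c [_ _ _ ->]].
by apply: Rintegral_ge0 => t _; exact: sqrtr_ge0.
Qed.

Lemma holder_limit (N : pt R -> frame V) (F G Fi : pt R -> {vspace V})
    (xi : R * R -> {vspace V}) (e K K' B b M H a : R) :
  e ^+ 2 = 1 -> 0 <= K -> 0 <= K' -> 0 <= B -> 0 < b -> 1 <= M ->
  0 < H -> 0 < a ->
  (forall x, UH x -> basis_of fullv (N x)) ->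
  (forall E : frame V, basis_of fullv E -> exists2 m : R, 0 <= m &
    forall s u, circle s ->
      normf E u <= m * normf (N (base_pt e s)) u /\
      normf (N (base_pt e s)) u <= m * normf E u) ->
  (forall n x u, UH x ->
    normf (N x) u <= M ^+ n * normf (N (flow (e * n%:R) x)) u /\
    normf (N (flow (e * n%:R) x)) u <= M ^+ n * normf (N x) u) ->
  (forall t x, UH x -> F (flow t x) = F x) ->
  (forall t x, UH x -> G (flow t x) = G x) ->
  (forall x, UH x -> (F x + G x = fullv)%VS) ->
  (forall x, UH x -> (Fi x + G x = fullv)%VS) ->
  (forall x u v, UH x -> u \in F x -> v \in G x ->
    normf (N x) u <= K * normf (N x) (u + v)) ->
  (forall x w v, UH x -> w \in Fi x -> v \in G x ->
    normf (N x) v <= K' * normf (N x) (w + v)) ->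
  (forall n x u v, UH x -> u \in F x -> v \in G x ->
    normf (N x) v * normf (N (flow (e * n.+1%:R) x)) u <=
    B * expR (- b * n.+1%:R) *
      normf (N (flow (e * n.+1%:R) x)) v * normf (N x) u) ->
  (forall x y, UH x -> UH y -> gap (N x) (Fi x) (Fi y) <= H * distUH x y `^ a) ->
  (forall s, circle s -> xi s = F (base_pt e s)) ->
  holder_map xi.
Proof.
move=> e1 K0 K'0 B0 b0 M1 H0 a0 bN base growth FE GE FG FiG sepF sepG dom hol lim.
have en1 (n : nat) : `|e * n%:R| = n%:R.
  by rewrite normrM normr_nat; have /eqP := e1; rewrite sqrf_eq1 =>
    /orP[] /eqP ->; rewrite ?normrN1 ?normr1 mul1r.
pose Z (n : nat) s := flow (e * n%:R) (base_pt e s).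
have UZ n s : circle s -> UH (Z n s) by move=> cs; apply/UH_flow/UH_base_pt.
have Ub s : circle s -> UH (base_pt e s) by exact: UH_base_pt.
apply: (@holder_criterion _ _ xi (fun n s => Fi (Z n s)) (fun n s => N (Z n s))
  (fun s => N (base_pt e s)) ((1 + K) * (K' * B)) b M H 6 a) => //.
- by rewrite mulr_ge0 ?addr_ge0 // mulr_ge0.
- by move=> n s cs; apply/bN/UZ.
- move=> n s cs; rewrite lim //; have Us := Ub s cs; have Uz := UZ n.+1 s cs.
  set q := expR _; have q0 : 0 <= q by exact: expR_ge0.
  have Bq : 0 <= B * q by exact: mulr_ge0.
  have FiGz : (Fi (Z n.+1 s) + G (base_pt e s) = fullv)%VS.
    by rewrite -(GE (e * n.+1%:R) _ Us) FiG.
  have sepGz w v : w \in Fi (Z n.+1 s) -> v \in G (base_pt e s) ->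
      normf (N (Z n.+1 s)) v <= K' * normf (N (Z n.+1 s)) (w + v).
    by move=> wFi vG; apply: sepG; rewrite // GE.
  have [n1 n2] := near_sub_graph K0 K'0 Bq (bN _ Us) (FG _ Us) FiGz
    (fun u v => sepF _ u v Us) sepGz (fun u v => dom n _ u v Us) (bN _ Uz).
  have KBq : 0 <= K' * (B * q) by exact: mulr_ge0.
  by split; [apply: near_subW n1 | apply: near_subW n2];
    rewrite -[X in _ <= X]mulrA -[X in _ <= _ * X]mulrA mulrDl mul1r
      ?lerDl ?lerDr // mulr_ge0.
- move=> n s s' cs cs'.
  apply: le_trans (le_trans (hol _ _ (UZ n s cs) (UZ n s' cs')) _).
    exact: half_gap_le_gap.
  rewrite ler_wpM2l ?(ltW H0) //; apply: ge0_ler_powR; first exact: ltW.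
  - by rewrite nnegrE distUH_ge0.
  - by rewrite nnegrE !mulr_ge0 ?expR_ge0.
  by rewrite -(en1 n) distUH_flow_base_pt.
- by move=> n s u cs; apply: growth; exact: Ub.
Qed.

Lemma addv_full F G : (F :&: G = 0)%VS ->
  (\dim F + \dim G = \dim {: V})%N -> (F + G = fullv)%VS.
Proof.
move=> FG d; apply/eqP; rewrite eqEdim subvf /= -d.
by rewrite -(dimv_sum_cap F G) FG dimv0 addn0.
Qed.

Lemma capv0_separated (X : frame V) F G (K : R) : basis_of fullv X ->
  (forall u v, u \in F -> v \in G -> normf X v <= K * normf X (u + v)) ->
  (F :&: G = 0)%VS.
Proof.
move=> bX sep; apply/eqP; rewrite -subv0; apply/subvP => u.
rewrite memv_cap => /andP[uF uG]; rewrite memv0 -(normf_eq0 _ bX).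
have := sep (- u) u; rewrite memvN addNr normf0 mulr0 => /(_ uF uG) u0.
by rewrite eq_le u0 normf_ge0.
Qed.

End LimitMaps.

Section UniformlyHyperbolic.
Variables (R : realType) (V : vectType R) (k : nat).
Variables (A : pt R -> {linear pt R -> 'End(V)}) (h : pt R -> frame V).
Variables (Phi : R -> pt R -> 'End(V)) (L P : pt R -> {vspace V}).
Hypothesis hyp : uniformly_hyperbolic k A h Phi L P.
Variable g : pt R -> 'End(V).
Hypothesis triv : trivialization A g.
Local Notation UH := (@UH R).
Local Notation N := (gauge_frame g h).
Local Notation gL := (gauge_space g L).
Local Notation gP := (gauge_space g P).

Let kg x : UH x -> lker (g x) = 0%VS.
Proof. by case: triv => + _ _; apply. Qed.

Let bh x : UH x -> basis_of fullv (h x).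
Proof. by case: (uh_frame hyp) => + _; apply. Qed.

Let bN x : UH x -> basis_of fullv (N x).
Proof. exact: basis_gauge_frame triv (uh_frame hyp). Qed.

Lemma gauge_lift t x u : UH x -> g (flow t x) (Phi t x u) = g x u.
Proof.
move=> Ux; have [Phi0 par] := uh_lift hyp Ux u.
have := gauge_parallel triv (C1_flow Ux) par t 0.
by rewrite /= flow0 Phi0.
Qed.

Lemma normf_gauge x u : UH x -> normf (N x) (g x u) = normf (h x) u.
Proof. by move=> Ux; apply: normf_image_frame; [exact: kg | exact: bh]. Qed.

Lemma normf_gauge_flow t x u : UH x ->
  normf (N (flow t x)) (g x u) = normf (h (flow t x)) (Phi t x u).
Proof.
move=> Ux; rewrite -(gauge_lift t u Ux).
by rewrite normf_gauge //; exact: UH_flow.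
Qed.

Lemma gauge_space_flow (F : pt R -> {vspace V}) t x : UH x ->
  (Phi t x @: F x = F (flow t x))%VS -> gauge_space g F (flow t x) = gauge_space g F x.
Proof.
move=> Ux FE; rewrite /gauge_space -FE -limg_comp; apply: eq_in_limg => u _.
by rewrite comp_lfunE /= gauge_lift.
Qed.

Lemma gauge_onto x w : UH x -> exists u, w = g x u.
Proof. by move=> Ux; exists ((g x)^-1%VF w); rewrite lker0_lfunVK // kg. Qed.

Lemma gauge_growth : exists2 M : R, 1 <= M & forall e : R, e ^+ 2 = 1 ->
  forall (n : nat) x w, UH x ->
    normf (N x) w <= M ^+ n * normf (N (flow (e * n%:R) x)) w /\
    normf (N (flow (e * n%:R) x)) w <= M ^+ n * normf (N x) w.
Proof.
have [M0 bM0] := uh_bounded hyp; pose M := Num.max 1 M0.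
have M1 : 1 <= M by rewrite le_max lexx.
have bM e x w : e ^+ 2 = 1 -> UH x -> normf (N (flow e x)) w <= M * normf (N x) w.
  move=> e1 Ux; have [u ->] := gauge_onto w Ux.
  rewrite normf_gauge_flow // normf_gauge //.
  apply: (@le_trans _ _ (M0 * normf (h x) u)); last first.
    by rewrite ler_wpM2r ?normf_ge0 // le_max lexx orbT.
  have [h1 h2] := bM0 x u Ux.
  by have /eqP := e1; rewrite sqrf_eq1 => /orP[] /eqP ->.
exists M => // e e1; elim=> [|n IHn] x w Ux.
  by rewrite mulr0 flow0 expr0 mul1r lexx.
have [h1 h2] := IHn x w Ux; have Un := UH_flow (e * n%:R) Ux.
have En : flow (e * n.+1%:R) x = flow e (flow (e * n%:R) x).
  by rewrite -flowD -natr1 mulrDr mulr1 addrC.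
have M0' : 0 <= M ^+ n by rewrite exprn_ge0 // (le_trans ler01).
have s1 := bM e _ w e1 Un.
have s2 := bM (- e) (flow e (flow (e * n%:R) x)) w _ (UH_flow _ Un).
rewrite sqrrN -flowD addNr flow0 in s2; have {}s2 := s2 e1.
rewrite En; split.
  by rewrite (le_trans h1) // exprSr -mulrA ler_wpM2l.
rewrite (le_trans s1) // exprS -mulrA ler_wpM2l //.
exact: le_trans ler01 M1.
Qed.

Lemma dim_P x : UH x -> \dim (P x) = (\dim {: V} - k)%N.
Proof.
move=> Ux; have sp := uh_splitting hyp.
have := dimv_sum_cap (L x) (P x).
rewrite (split_cap sp Ux) (split_add sp Ux) (split_dim sp Ux) dimv0 addn0 => ->.
by rewrite addKn.
Qed.

Lemma gauge_separation : exists2 K : R, 0 <= K & forall x u v, UH x ->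
  u \in gL x -> v \in gP x ->
  normf (N x) u <= K * normf (N x) (u + v) /\
  normf (N x) v <= K * normf (N x) (u + v).
Proof.
have [e e0 he] := uh_angle hyp.
have [K K1 sep] := angle_separation V (mulr_gt0 (ltr0Sn _ 1) e0 : 0 < 2 * e).
exists K => [|x _ _ Ux /memv_imgP[u uL ->] /memv_imgP[v vP ->]].
  exact: le_trans ler01 K1.
rewrite -linearD !normf_gauge //; apply: sep (bh Ux) _ _ _ uL vP.
apply: he => //; split.
- exact: (split_dim (uh_splitting hyp) Ux).
- by move=> U d xU d0; exists x; split=> //; rewrite ?gapxx //; exact: nbhs_singleton.
- exact: dim_P.
- by move=> U d xU d0; exists x; split=> //; rewrite ?gapxx //; exact: nbhs_singleton.
Qed.

Lemma gauge_domination : exists B b : R, [/\ 0 <= B, 0 < b &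
  forall s x u v, 0 < s -> UH x -> u \in gL x -> v \in gP x ->
    normf (N x) v * normf (N (flow s x)) u <=
    B * expR (- b * s) * normf (N (flow s x)) v * normf (N x) u].
Proof.
have [B [b [B0 b0 dom]]] := uh_dominated hyp; exists B, b; split=> //; first exact: ltW.
move=> s x _ _ s0 Ux /memv_imgP[u uL ->] /memv_imgP[v vP ->].
rewrite !normf_gauge_flow // !normf_gauge //.
have [->|u0] := eqVneq u 0; first by rewrite linear0 !normf0 !mulr0.
have [->|v0] := eqVneq v 0; first by rewrite linear0 !normf0 mulr0 !mul0r.
have up := normf_gt0 (bh Ux) u0; have vp := normf_gt0 (bh Ux) v0.
have := dom s x u v s0 Ux uL vP u0 v0.
by rewrite mulrA ler_pdivlMr // mulrAC ler_pdivrMr // mulrC.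
Qed.

Lemma holder_limit_maps Li Pi (e1 H a : R) xi xi' :
  0 < e1 -> 0 < H -> 0 < a -> holder_splitting k g h L P Li Pi e1 H a ->
  limit_map g L xi -> dual_limit_map g P xi' -> holder_map xi /\ holder_map xi'.
Proof.
move=> e10 H0 a0 hs lim dual.
have sp := uh_splitting hyp.
have [M M1 growth] := gauge_growth.
have [K K0 sep] := gauge_separation.
have [B [b [B0 b0 dom]]] := gauge_domination.
have [K' K'1 sep'] := angle_separation V e10.
have K'0 : 0 <= K' by exact: le_trans ler01 K'1.
have invL t x : UH x -> gL (flow t x) = gL x.
  by move=> Ux; apply: gauge_space_flow => //; exact: split_invL sp t x Ux.
have invP t x : UH x -> gP (flow t x) = gP x.
  by move=> Ux; apply: gauge_space_flow => //; exact: split_invP sp t x Ux.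
have gLP x : UH x -> (gL x + gP x = fullv)%VS.
  by move=> Ux; rewrite -limgD (split_add sp Ux) lker0_limgf // kg.
have dimL x : UH x -> \dim (gL x) = k.
  by move=> Ux; rewrite limg_dim_eq ?(split_dim sp Ux) // kg // capv0.
have dimP x : UH x -> \dim (gP x) = (\dim {: V} - k)%N.
  by move=> Ux; rewrite limg_dim_eq ?dim_P // kg // capv0.
have kV : (k <= \dim {: V})%N.
  have Uo : UH (base_pt 1 (1, 0)).
    by apply: UH_base_pt; rewrite /circle ?expr1n //= expr0n addr0 expr1n.
  by rewrite -(split_dim sp Uo); exact/dimvS/subvf.
have dimPi x : UH x -> \dim (Pi x) = (\dim {: V} - k)%N.
  move=> Ux; have := dimv_sum_cap (Li x) (Pi x).
  rewrite (hs_cap hs Ux) (hs_add hs Ux) (hs_dim hs Ux) dimv0 addn0 => ->.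
  by rewrite addKn.
have one : (1 : R) ^+ 2 = 1 by rewrite expr1n.
have mone : (-1 : R) ^+ 2 = 1 by rewrite sqrrN expr1n.
split.
- apply: (@holder_limit R V N gL gP Li xi 1 K K' B b M H a) => //.
  + by move=> E bE; exact: base_circle_compare triv (uh_frame hyp) one bE.
  + exact: growth.
  + move=> x Ux; apply: addv_full; last by rewrite (hs_dim hs Ux) dimP // subnKC.
    apply: (capv0_separated (bN Ux)) => u v uLi vP.
    exact: (sep' _ _ _ (bN Ux) (hs_angleL hs Ux) _ _ uLi vP).2.
  + by move=> x u v Ux uL vP; exact: (sep x u v Ux uL vP).1.
  + by move=> x w v Ux wL vP; exact: (sep' _ _ _ (bN Ux) (hs_angleL hs Ux) _ _ wL vP).2.
  + by move=> n x u v Ux uL vP; rewrite mul1r; exact: dom.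
  + exact: hs_holderL hs.
  + by move=> s cs; rewrite -{1}(fwd_base_pt s) lim //; exact: UH_base_pt.
- apply: (@holder_limit R V N gP gL Pi xi' (-1) K K' B b M H a) => //.
  + by move=> E bE; exact: base_circle_compare triv (uh_frame hyp) mone bE.
  + exact: growth.
  + by move=> x Ux; rewrite addvC gLP.
  + move=> x Ux; apply: addv_full; last by rewrite dimPi // dimL // subnK.
    apply: (capv0_separated (bN Ux)) => u v uPi vL.
    by rewrite addrC; exact: (sep' _ _ _ (bN Ux) (hs_angleP hs Ux) _ _ vL uPi).1.
  + by move=> x u v Ux uP vL; rewrite addrC; exact: (sep x v u Ux vL uP).2.
  + move=> x w v Ux wPi vL; rewrite addrC.
    exact: (sep' _ _ _ (bN Ux) (hs_angleP hs Ux) _ _ vL wPi).1.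
  + move=> n x u v Ux uP vL; rewrite mulN1r.
    set z := flow _ x; have Uz : UH z by exact: UH_flow.
    have xz : x = flow n.+1%:R z by rewrite /z -flowD subrr flow0.
    have uP' : u \in gP z by rewrite /z invP.
    have vL' : v \in gL z by rewrite /z invL.
    have := dom n.+1%:R z v u (ltr0Sn _ _) Uz vL' uP'; rewrite -xz => le.
    by rewrite [leLHS]mulrC [leRHS]mulrAC.
  + exact: hs_holderP hs.
  + by move=> s cs; rewrite -{1}(bwd_base_pt s) dual //; exact: UH_base_pt.
Qed.

End UniformlyHyperbolic.

Lemma holder_map_image (R : realType) (V : vectType R) (T : 'End(V))
    (xi : R * R -> {vspace V}) :
  lker T = 0%VS -> holder_map (fun s => (T @: xi s)%VS) -> holder_map xi.
Proof.
move=> kT hol e be; have bTe := basis_image_frame kT be.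
have half F G : half_gap e F G <= half_gap (image_frame T e) (T @: F)%VS (T @: G)%VS.
  apply/ler_addgt0Pr => d d0.
  have lt : half_gap (image_frame T e) (T @: F)%VS (T @: G)%VS <
      half_gap (image_frame T e) (T @: F)%VS (T @: G)%VS + d by rewrite ltrDl.
  apply: half_gap_le; first by rewrite addr_ge0 ?half_gap_ge0 ?ltW.
  move=> u uF; have [_ /memv_imgP[v vG ->]] :=
    near_sub_half_gap bTe (lexx _) lt (memv_img T uF).
  by rewrite -linearB !normf_image_frame // => uv; exists v.
have [C [a [a0 a1 Ca]]] := hol _ bTe; exists C, a; split=> // s t cs ct.
have := Ca s t cs ct; rewrite /gap !ge_max => /andP[h1 h2].
by rewrite (le_trans (half _ _) h1) (le_trans (half _ _) h2).
Qed.

Theorem proposition2p1p6 (R : realType) (V : vectType R) (k : nat)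
    (A : pt R -> {linear pt R -> 'End(V)}) (h : pt R -> frame V)
    (Phi : R -> pt R -> 'End(V)) (L P : pt R -> {vspace V})
    (hyp : uniformly_hyperbolic k A h Phi L P)
    (g : pt R -> 'End(V)) (triv : trivialization A g)
    (xi xi' : (R * R)%type -> {vspace V})
    (lim : limit_map g L xi) (dual : dual_limit_map g P xi') :
  holder_map xi /\ holder_map xi'.
Proof.
have [g' [Li [Pi [triv' [e1 [H [a [e10 H0 a0 hs]]]]]]]] := uh_holder hyp.
have [T kT gT] := trivialization_unique triv triv'.
have E F x : UH x -> gauge_space g' F x = (T @: gauge_space g F x)%VS.
  by move=> Ux; rewrite /gauge_space gT // limg_comp.
have lim' : limit_map g' L (fun s => (T @: xi s)%VS).
  by move=> y Uy; rewrite lim // E.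
have dual' : dual_limit_map g' P (fun s => (T @: xi' s)%VS).
  by move=> y Uy; rewrite dual // E.
have [h1 h2] := holder_limit_maps hyp triv' e10 H0 a0 hs lim' dual'.
by split; apply: holder_map_image kT _.
Qed.
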